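(* Let $\gamma$ and $\Gamma$ be ellipses in $\mathbb{R}^2$ with $\gamma$ contained in the interior of $\Gamma$, and let $n \ge 3$. Suppose the pair $(\gamma,\Gamma)$ admits a one-parameter family $\{P_t\}$ of Poncelet $n$-gons (closed $n$-gons inscribed in $\Gamma$ and circumscribed about $\gamma$), obtained by letting the initial vertex range over $\Gamma$. Then each of the two loci $\{CM_0(P_t)\}$ and $\{CM_2(P_t)\}$ is either an ellipse homothetic to $\Gamma$ or a single point.
   Context: A Poncelet $n$-gon for the pair $(\gamma,\Gamma)$ is a polygon $P=(A_1,\dots,A_n)$ with all vertices on $\Gamma$, each side $A_iA_{i+1}$ (indices mod $n$) tangent to $\gamma$, and with consecutive sides being the two distinct tangent lines from $A_{i+1}$ to $\gamma$, so that after $n$ steps of the construction ''from $A_i$ draw the other tangent line to $\gamma$ and let $A_{i+1}$ be its second intersection with $\Gamma$'' one returns to $A_1$. Writing $A_i=(x_i,y_i)$ and $d_i = x_i y_{i+1} - x_{i+1} y_i$ (indices mod $n$), and $A(P)=\tfrac12\sum_{i=1}^n d_i$ (signed area), define the vertex centroid $CM_0(P)=\frac1n\sum_{i=1}^n (x_i,y_i)$ and the lamina centroid $CM_2(P)=\frac{1}{6A(P)}\sum_{i=1}^n d_i\,(x_i+x_{i+1},\,y_i+y_{i+1})$ (for an embedded polygon this is the centroid of the polygon as a homogeneous region). An ellipse is homothetic to $\Gamma$ if it is the image of $\Gamma$ under a map $z\mapsto \lambda z + c$ with $\lambda>0$, $c\in\mathbb{R}^2$. *)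

(* Defs.v *)
From Stdlib Require Import Reals Lra List Arith.
Open Scope R_scope.

Definition point := (R * R)%type.

(* An ellipse: { (x,y) | a (x-cx)^2 + 2 b (x-cx)(y-cy) + c (y-cy)^2 = 1 }
   with the quadratic form positive definite. *)
Record ellipse := mkEllipse { ecx : R; ecy : R; ea : R; eb : R; ec : R }.

Definition ellipse_wf (E : ellipse) : Prop :=
  0 < ea E /\ 0 < ea E * ec E - eb E * eb E.

Definition eform (E : ellipse) (p : point) : R :=
  let u := fst p - ecx E in let v := snd p - ecy E in
  ea E * u * u + 2 * eb E * u * v + ec E * v * v.

Definition on_ellipse (E : ellipse) (p : point) : Prop := eform E p = 1.
Definition in_interior (E : ellipse) (p : point) : Prop := eform E p < 1.

Definition ellipse_inside (g G : ellipse) : Prop :=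
  forall p, on_ellipse g p -> in_interior G p.

Definition on_line (A B p : point) : Prop :=
  exists t : R, p = (fst A + t * (fst B - fst A), snd A + t * (snd B - snd A)).

Definition tangent_line (g : ellipse) (A B : point) : Prop :=
  A <> B /\ exists! q, on_ellipse g q /\ on_line A B q.

Definition vtx (n : nat) (P : nat -> point) (i : nat) : point := P (i mod n)%nat.

(* Poncelet n-gon for (g, G): vertices on G, each side A_i A_{i+1} tangent to g,
   and the sides A_i A_{i+1}, A_{i+1} A_{i+2} are distinct lines (the two
   distinct tangents from A_{i+1}). *)
Definition poncelet_ngon (g G : ellipse) (n : nat) (P : nat -> point) : Prop :=
  forall i : nat, (i < n)%nat ->
    on_ellipse G (vtx n P i) /\
    tangent_line g (vtx n P i) (vtx n P (S i)) /\
    ~ on_line (vtx n P (S i)) (vtx n P (S (S i))) (vtx n P i).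

Definition sumR (n : nat) (f : nat -> R) : R :=
  fold_right Rplus 0 (map f (seq 0 n)).

Definition dcross (n : nat) (P : nat -> point) (i : nat) : R :=
  fst (vtx n P i) * snd (vtx n P (S i)) - fst (vtx n P (S i)) * snd (vtx n P i).

Definition signed_area (n : nat) (P : nat -> point) : R :=
  / 2 * sumR n (dcross n P).

Definition CM0 (n : nat) (P : nat -> point) : point :=
  (/ INR n * sumR n (fun i => fst (vtx n P i)),
   / INR n * sumR n (fun i => snd (vtx n P i))).

Definition CM2 (n : nat) (P : nat -> point) : point :=
  (/ (6 * signed_area n P) *
     sumR n (fun i => dcross n P i * (fst (vtx n P i) + fst (vtx n P (S i)))),
   / (6 * signed_area n P) *
     sumR n (fun i => dcross n P i * (snd (vtx n P i) + snd (vtx n P (S i))))).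

Definition homothetic_ellipse (G : ellipse) (S : point -> Prop) : Prop :=
  exists (lam : R) (c : point), 0 < lam /\
    forall p, S p <-> exists z, on_ellipse G z /\
      p = (lam * fst z + fst c, lam * snd z + snd c).

Definition single_point (S : point -> Prop) : Prop :=
  exists p0 : point, forall p, S p <-> p = p0.

Definition locus (F : nat -> (nat -> point) -> point) (g G : ellipse) (n : nat)
  : point -> Prop :=
  fun p => exists P, poncelet_ngon g G n P /\ p = F n P.

(* Main.v *)
(* Choose complex coordinates p in which gamma is the unit circle and z in which
   Gamma is the unit circle; z = o + mu p + nu p^* for constants o, mu, nu.  Let a
   Poncelet polygon Q have vertices q_j (in the z coordinate) and tangent
   lengths l_j to gamma.  The function

     v_Q(z) = sum_j l_j q_j / (q_j - z)

   takes the same value at both ends of any chord of Gamma tangent to gamma,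
   because the difference telescopes along the sides of Q.  Hence it is constant,
   say c, on the vertices of any other Poncelet polygon R.  Put L = sum_j l_j and
   E = sum_j l_j q_j.  On the unit circle v_Q + v_Q^* = L, so c + c^* = L, and
   exchanging double sums gives E_R / L_R = - (c^* / c) E_Q / L_Q.  Thus E / L
   stays on a circle about 0, and it reaches every point of it because all
   solutions z of v_Q(z) = c are unimodular when c + c^* = L.

   The vertices of R are the roots of the numerator of v_Q - c; comparing the two
   leading coefficients shows that (sum of the vertices) - E / L is the same for
   all polygons, which settles CM_0.  In the p coordinate twice the area of a
   polygon is the sum of l_j + l_(j+1), and splitting it into triangles with apex
   at the centre of gamma gives 3 CM_2 = E / L + 2 o. *)

Require Import Defs.
From Stdlib Require Import Reals Lra.
Open Scope R_scope.

(** * Polars and Cholesky coordinates of an ellipse *)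

Definition bform (E : ellipse) (P Q : point) : R :=
  ea E * (fst P - ecx E) * (fst Q - ecx E) +
  eb E * ((fst P - ecx E) * (snd Q - ecy E) + (snd P - ecy E) * (fst Q - ecx E)) +
  ec E * (snd P - ecy E) * (snd Q - ecy E).

(** Completing the square: [a] times the form is a square plus a positive multiple of $v^2$. *)
Lemma definite_neq0 a b c u v : 0 < a -> 0 < a * c - b * b ->
  (u <> 0 \/ v <> 0) -> a * u * u + 2 * b * u * v + c * v * v <> 0.
Proof.
intros ha hd huv h.
assert (e : (a * u + b * v) * (a * u + b * v) + (a * c - b * b) * (v * v) = 0).
{ replace 0 with (a * (a * u * u + 2 * b * u * v + c * v * v)) by (rewrite h; ring).
  ring. }
assert (v0 : v = 0).
{ apply Rsqr_0_uniq; unfold Rsqr.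
  assert (0 <= (a * u + b * v) * (a * u + b * v)) by apply Rle_0_sqr.
  assert (0 <= v * v) by apply Rle_0_sqr. nra. }
subst v; destruct huv as [hu | hv]; [| lra].
assert (e' : (a * u) * (a * u) = 0) by (rewrite <- e; ring).
apply Rmult_integral in e'; destruct e' as [e' | e'];
  apply Rmult_integral in e'; lra.
Qed.

Lemma point_neq (A B : point) : A <> B ->
  fst B - fst A <> 0 \/ snd B - snd A <> 0.
Proof.
intros h; destruct (Req_dec (fst B - fst A) 0) as [e |]; [| now left].
right; intros e'; apply h; destruct A, B; simpl in *; f_equal; lra.
Qed.

(* If the line through [q] had non-zero slope against the polar of [q], it
   would meet the ellipse again at the reflected parameter. *)
Lemma tangent_polar (g : ellipse) (A B : point) :
  ellipse_wf g -> tangent_line g A B ->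
  exists q, on_ellipse g q /\ bform g q A = 1 /\ bform g q B = 1.
Proof.
intros [ha hd] [hAB [q [[hq [s hs]] huniq]]].
exists q; split; [exact hq |].
set (u := fst B - fst A) in *; set (v := snd B - snd A) in *.
pose (D := ea g * u * u + 2 * eb g * u * v + ec g * v * v).
assert (hD : D <> 0) by (apply definite_neq0; auto; apply point_neq; auto).
pose (b := ea g * (fst q - ecx g) * u
   + eb g * ((fst q - ecx g) * v + (snd q - ecy g) * u) + ec g * (snd q - ecy g) * v).
pose (r := s - 2 * b / D).
assert (hq' : on_ellipse g q) by exact hq.
unfold on_ellipse, eform in hq; cbv zeta in hq.
assert (e : q = (fst A + r * u, snd A + r * v)).
{ apply huniq; split; [| now exists r].
  unfold on_ellipse, eform; cbv zeta; simpl.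
  rewrite <- hq.
  replace (fst A + r * u - ecx g) with (fst q - ecx g - 2 * b / D * u)
    by (rewrite hs; unfold r; simpl; ring).
  replace (snd A + r * v - ecy g) with (snd q - ecy g - 2 * b / D * v)
    by (rewrite hs; unfold r; simpl; ring).
  set (k := 2 * b / D).
  transitivity (ea g * (fst q - ecx g) * (fst q - ecx g) +
    2 * eb g * (fst q - ecx g) * (snd q - ecy g) +
    ec g * (snd q - ecy g) * (snd q - ecy g) - 2 * k * b + k * k * D);
    [unfold b, D; ring | unfold k; field; auto]. }
assert (b0 : b = 0).
{ rewrite hs in e; unfold r in e; injection e as e1 e2.
  assert (f1 : b / D * u = 0) by lra. assert (f2 : b / D * v = 0) by lra.
  destruct (point_neq A B hAB) as [h | h]; fold u v in h.
  - apply Rmult_integral in f1; destruct f1 as [f1 |]; [| easy].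
    replace b with (b / D * D) by (field; auto); rewrite f1; ring.
  - apply Rmult_integral in f2; destruct f2 as [f2 |]; [| easy].
    replace b with (b / D * D) by (field; auto); rewrite f2; ring. }
assert (x1 : fst q = fst A + s * u) by (rewrite hs; reflexivity).
assert (x2 : snd q = snd A + s * v) by (rewrite hs; reflexivity).
assert (hA : bform g q A = 1 - s * b).
{ rewrite <- hq; unfold bform, b.
  replace (fst A) with (fst q - s * u) by lra.
  replace (snd A) with (snd q - s * v) by lra. ring. }
split; [rewrite hA, b0; ring |].
replace (bform g q B) with (bform g q A + b); [rewrite hA, b0; ring |].
unfold bform, b, u, v; ring.
Qed.

(** The polar of [q] is a line with normal [(n1, n2)], nonzero because the value 1 is attained, so
    the directions from [A] to [B] and to [C] are parallel. This converts distinct sides into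
    distinct tangency points. *)
Lemma polar_collinear (g : ellipse) (q A B C : point) :
  A <> B -> bform g q A = 1 -> bform g q B = 1 -> bform g q C = 1 -> on_line A B C.
Proof.
intros hAB eA eB eC.
pose (n1 := ea g * (fst q - ecx g) + eb g * (snd q - ecy g)).
pose (n2 := eb g * (fst q - ecx g) + ec g * (snd q - ecy g)).
assert (f : forall P, bform g q P = n1 * (fst P - ecx g) + n2 * (snd P - ecy g))
  by (intros P; unfold bform, n1, n2; ring).
rewrite f in eA, eB, eC.
set (u := fst B - fst A); set (v := snd B - snd A).
assert (huv : u <> 0 \/ v <> 0) by (apply point_neq; auto).
set (x := fst C - fst A); set (y := snd C - snd A).
assert (e1 : n1 * u + n2 * v = 0) by (unfold u, v; lra).
assert (e2 : n1 * x + n2 * y = 0) by (unfold x, y; lra).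
assert (hn : n1 <> 0 \/ n2 <> 0).
{ destruct (Req_dec n1 0) as [h |]; [| now left]. right; intros h'.
  rewrite h, h' in eA; lra. }
assert (cr : u * y - x * v = 0).
{ destruct hn as [h | h].
  - apply (Rmult_eq_reg_l n1); auto.
    replace (n1 * (u * y - x * v)) with ((n1 * u + n2 * v) * y - (n1 * x + n2 * y) * v) by ring.
    rewrite e1, e2; ring.
  - apply (Rmult_eq_reg_l n2); auto.
    replace (n2 * (u * y - x * v)) with ((n1 * x + n2 * y) * u - (n1 * u + n2 * v) * x) by ring.
    rewrite e1, e2; ring. }
assert (hN : u * u + v * v <> 0).
{ assert (0 <= u * u) by apply Rle_0_sqr. assert (0 <= v * v) by apply Rle_0_sqr.
  destruct huv as [h | h]; [assert (u * u <> 0) | assert (v * v <> 0)];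
  try (intros h'; apply Rmult_integral in h'; tauto); lra. }
(* Parameter of the orthogonal projection of [C] onto the line; by [cr] the projection is [C]
   itself. *)
exists ((x * u + y * v) / (u * u + v * v)); fold u v.
rewrite (surjective_pairing C); f_equal.
- apply (Rplus_eq_reg_r (- fst A)); fold (fst C - fst A); fold x.
  replace x with ((x * (u * u + v * v)) / (u * u + v * v)) at 1 by (field; auto).
  replace (x * (u * u + v * v)) with ((x * u + y * v) * u - v * (u * y - x * v)) by ring.
  rewrite cr; field; auto.
- apply (Rplus_eq_reg_r (- snd A)); fold (snd C - snd A); fold y.
  replace y with ((y * (u * u + v * v)) / (u * u + v * v)) at 1 by (field; auto).
  replace (y * (u * u + v * v)) with ((x * u + y * v) * v + u * (u * y - x * v)) by ring.
  rewrite cr; field; auto.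
Qed.

(* Cholesky coordinates: they carry the ellipse to the unit circle. *)
Definition chol11 E := sqrt (ea E).
Definition chol12 E := eb E / sqrt (ea E).
Definition chol22 E := sqrt (ec E - eb E * eb E / ea E).

Definition chart1 E (P : point) :=
  chol11 E * (fst P - ecx E) + chol12 E * (snd P - ecy E).
Definition chart2 E (P : point) := chol22 E * (snd P - ecy E).

Definition unchart E (a b : R) : point :=
  (ecx E + (a - chol12 E * b / chol22 E) / chol11 E, ecy E + b / chol22 E).

Lemma chol11_gt0 E : ellipse_wf E -> 0 < chol11 E.
Proof. intros [h _]; apply sqrt_lt_R0; auto. Qed.

Lemma chol22_arg E : ellipse_wf E -> 0 < ec E - eb E * eb E / ea E.
Proof.
intros [h d]; replace (ec E - eb E * eb E / ea E)
  with ((ea E * ec E - eb E * eb E) / ea E) by (field; lra).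
apply Rdiv_lt_0_compat; auto.
Qed.

Lemma chol22_gt0 E : ellipse_wf E -> 0 < chol22 E.
Proof. intros h; apply sqrt_lt_R0, chol22_arg; auto. Qed.

(** The Cholesky factorisation turns the bilinear form into the Euclidean inner product, so polars
    with respect to [E] become polars with respect to the unit circle. *)
Lemma chart_bform E P Q : ellipse_wf E ->
  chart1 E P * chart1 E Q + chart2 E P * chart2 E Q = bform E P Q.
Proof.
intros w; assert (h := chol11_gt0 E w); assert (h0 := chol22_arg E w); destruct w as [h1 _].
assert (s1 : chol11 E * chol11 E = ea E) by (apply sqrt_sqrt; lra).
assert (s2 : chol22 E * chol22 E = ec E - eb E * eb E / ea E) by (apply sqrt_sqrt; lra).
assert (s3 : chol11 E * chol12 E = eb E) by (unfold chol12, chol11 in *; field; lra).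
assert (s4 : chol12 E * chol12 E = eb E * eb E / ea E).
{ apply (Rmult_eq_reg_l (ea E)); [| lra]; rewrite <- s1 at 1.
  replace (chol11 E * chol11 E * (chol12 E * chol12 E))
    with ((chol11 E * chol12 E) * (chol11 E * chol12 E)) by ring.
  rewrite s3; field; lra. }
unfold chart1, chart2, bform.
replace (ec E) with (chol12 E * chol12 E + chol22 E * chol22 E) by (rewrite s2, s4; ring).
rewrite <- s1, <- s3; ring.
Qed.

Lemma bform_diag E P : bform E P P = eform E P.
Proof. unfold bform, eform; ring. Qed.

Lemma chart1_unchart E a b : ellipse_wf E -> chart1 E (unchart E a b) = a.
Proof.
intros w; assert (h := chol11_gt0 E w); assert (h' := chol22_gt0 E w).
unfold chart1, unchart; simpl; field; lra.
Qed.

Lemma chart2_unchart E a b : ellipse_wf E -> chart2 E (unchart E a b) = b.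
Proof.
intros w; assert (h' := chol22_gt0 E w).
unfold chart2, unchart; simpl; field; lra.
Qed.

Lemma unchart_chart E P : ellipse_wf E -> unchart E (chart1 E P) (chart2 E P) = P.
Proof.
intros w; assert (h := chol11_gt0 E w); assert (h' := chol22_gt0 E w).
destruct P as [x y]; unfold chart1, chart2, unchart; simpl; f_equal; field; lra.
Qed.

(** Linear part of the change from the chart of [g] to that of [G]; it is upper triangular because
    both Cholesky factors are. *)
Definition trans11 g G := chol11 G / chol11 g.
Definition trans12 g G := (chol12 G - chol11 G * chol12 g / chol11 g) / chol22 g.
Definition trans22 g G := chol22 G / chol22 g.

Lemma chart1_trans g G P : ellipse_wf g ->
  chart1 G P = chart1 G (ecx g, ecy g) +
    trans11 g G * chart1 g P + trans12 g G * chart2 g P.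
Proof.
intros w; assert (h := chol11_gt0 g w); assert (h' := chol22_gt0 g w).
unfold chart1, chart2, trans11, trans12; simpl; field; lra.
Qed.

Lemma chart2_trans g G P : ellipse_wf g ->
  chart2 G P = chart2 G (ecx g, ecy g) + trans22 g G * chart2 g P.
Proof.
intros w; assert (h' := chol22_gt0 g w).
unfold chart2, trans22; simpl; field; lra.
Qed.

(* Kept in a module because MathComp gives [3 <= n] on [nat] another meaning. *)
Module PonceletPencil.

From mathcomp Require Import all_boot all_order all_algebra.
From mathcomp Require Import complex Rstruct boolp.
From mathcomp Require Import ring.
Set Implicit Arguments. Unset Strict Implicit. Unset Printing Implicit Defensive.
Import Order.TTheory GRing.Theory Num.Theory.
Local Open Scope ring_scope.

(** * Numerators of sums of simple fractions *)

Section LevelPolynomial.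
Variables (F : fieldType) (n : nat) (z a : 'I_n -> F) (c : F).
Hypotheses (n_gt0 : (0 < n)%N) (c_neq0 : c != 0).

(** Numerator of $c + \sum_i a_i/(X - z_i)$ over the common denominator. *)
Definition level_poly : {poly F} :=
  c *: \prod_i ('X - (z i)%:P) +
  \sum_i a i *: \prod_(j | j != i) ('X - (z j)%:P).

Lemma size_prodD1_XsubC i : size (\prod_(j | j != i) ('X - (z j)%:P)) = n.
Proof.
rewrite -big_filter size_prod_XsubC.
have [e _ _ [_ ->]] := big_enumP.
by rewrite (cardC1 i) card_ord prednK.
Qed.

Lemma size_residues :
  (size (\sum_i a i *: \prod_(j | j != i) ('X - (z j)%:P))%R <= n)%N.
Proof.
apply: (leq_trans (size_sum _ _ _)); apply/bigmax_leqP => i _.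
by rewrite (leq_trans (size_scale_leq _ _)) // size_prodD1_XsubC.
Qed.

Lemma size_prod_ord : size (\prod_i ('X - (z i)%:P)) = n.+1.
Proof.
by rewrite size_prod_XsubC /index_enum -enumT size_enum_ord.
Qed.

Lemma size_level_poly : size level_poly = n.+1.
Proof.
rewrite /level_poly size_polyDl size_scale ?size_prod_ord //.
by rewrite ltnS size_residues.
Qed.

Lemma lead_coef_level_poly : lead_coef level_poly = c.
Proof.
rewrite /level_poly lead_coefDl ?lead_coefZ ?lead_coef_prod_XsubC ?mulr1 //.
by rewrite size_scale // size_prod_ord ltnS size_residues.
Qed.

(** Vieta gives the share of the full product; each cofactor is monic of degree [n.-1] and adds its
    [a i]. *)
Lemma level_poly_subleading :
  level_poly`_n.-1 = - c * \sum_i z i + \sum_i a i.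
Proof.
rewrite /level_poly coefD coefZ coef_sum mulNr -mulrN; congr (_ * _ + _).
  rewrite -(big_map z xpredT (fun u => 'X - u%:P)) -(big_map z xpredT id) /=.
  have e : size (map z (index_enum 'I_n)) = n.
    apply/eq_add_S.
    by rewrite -size_prod_ord -(size_prod_XsubC (map _ _) id) big_map.
  by have := @coefPn_prod_XsubC _ (map z (index_enum 'I_n)); rewrite e -lt0n; apply.
apply: eq_bigr => i _; rewrite coefZ.
have := lead_coef_prod_XsubC (index_enum 'I_n) [pred j | j != i] z.
by rewrite lead_coefE size_prodD1_XsubC => ->; rewrite mulr1.
Qed.

Lemma horner_level_poly y : (forall i, y != z i) ->
  level_poly.[y] = \prod_i (y - z i) * (c + \sum_i a i / (y - z i)).
Proof.
move=> yz; rewrite /level_poly hornerD hornerZ horner_prod mulrDr mulrC.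
congr (_ + _).
  by congr (_ * _); apply: eq_bigr => i _; rewrite hornerXsubC.
rewrite horner_sum mulr_sumr; apply: eq_bigr => i _.
rewrite hornerZ horner_prod [in RHS](bigD1 i) //=.
have yi : y - z i != 0 by rewrite subr_eq0.
rewrite (eq_bigr (fun j => y - z j)); last by move=> j _; rewrite hornerXsubC.
by field.
Qed.

(** Only the cofactor omitting [z i] survives, so a node with nonzero residue and distinct from the
    others is not a root. *)
Lemma horner_level_poly_node i :
  level_poly.[z i] = a i * \prod_(j | j != i) (z i - z j).
Proof.
rewrite /level_poly hornerD hornerZ horner_prod (bigD1 i) //= hornerXsubC subrr.
rewrite mul0r mulr0 add0r horner_sum (bigD1 i) //= [X in _ + X]big1 => [|k ki].
  rewrite addr0 hornerZ horner_prod; congr (_ * _).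
  by apply: eq_bigr => j _; rewrite hornerXsubC.
rewrite hornerZ horner_prod (bigD1 i) 1?eq_sym //= hornerXsubC subrr.
by rewrite mul0r mulr0.
Qed.

End LevelPolynomial.

Lemma sum_shift (V : zmodType) (n : nat) (f : nat -> V) : f n = f 0 ->
  \sum_(i < n) f i.+1 = \sum_(i < n) f i.
Proof.
move=> fn; apply: (addrI (f 0)).
have -> : f 0 + \sum_(i < n) f i.+1 = \sum_(i < n.+1) f i by rewrite big_ord_recl.
by rewrite big_ord_recr /= fn addrC.
Qed.

(** * Poncelet polygons in complex coordinates *)

Section Pencil.
Variables (C : numClosedFieldType) (o mu nu : C).

Definition unimod (u : C) := u * u^* = 1.

(* A point with coordinate [p] in a frame where the inner ellipse is the unit
   circle has coordinate [outer p] in a frame where the outer one is. *)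
Definition outer (p : C) := o + mu * p + nu * p^*.
(* For unimodular [t] this says [Re (p / t) = 1]. *)
Definition tangent_at (t p : C) := p + p^* * t ^+ 2 = 2 * t.

(** Determinant of the real-linear part of [outer]. *)
Let kappa := mu * mu^* - nu * nu^*.
Hypothesis kappa_neq0 : kappa != 0.
Hypothesis nested : forall t, unimod t -> outer t * (outer t)^* < 1.

(* [L0 t * X ^+ 2 - L1 t * X + L2 t] has as roots the two points of the outer
   ellipse on the tangent line at [t]. *)
Let L0 t := mu^* - nu^* * t ^+ 2.
Let L1 t := (o^* * mu - o * nu^*) * t ^+ 2 + 2 * kappa * t + (o * mu^* - o^* * nu).
Let L2 t := mu * t ^+ 2 - nu.

(** * Tangent chords of the outer ellipse *)

Lemma unimod_neq0 u : unimod u -> u != 0.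
Proof.
move=> hu; apply/eqP => u0; move: hu; rewrite /unimod u0 mul0r => /esym/eqP.
by rewrite oner_eq0.
Qed.

Lemma unimod_conj u : unimod u -> u^* = u^-1.
Proof.
by move=> hu; have u0 := unimod_neq0 hu; apply: (mulfI u0); rewrite hu divff.
Qed.

Lemma outer_inj : injective outer.
Proof.
move=> p q e; apply/eqP; rewrite -subr_eq0; apply/eqP; apply: (mulfI kappa_neq0).
have e' : (outer p)^* = (outer q)^* by rewrite e.
move: e e'; rewrite /outer !rmorphD !rmorphM /= !conjCK => e e'.
rewrite mulr0 /kappa.
have -> : (mu * mu^* - nu * nu^*) * (p - q) =
  mu^* * ((o + mu * p + nu * p^*) - (o + mu * q + nu * q^*)) -
  nu * ((o^* + mu^* * p^* + nu^* * p) - (o^* + mu^* * q^* + nu^* * q)) by ring.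
by rewrite e e' !subrr !mulr0 subr0.
Qed.

(** On the outer ellipse the conjugate of [outer p] is its inverse, so tangency at [t] becomes a
    quadratic equation in [outer p]. *)
Lemma chord_form t p : unimod (outer p) ->
  L0 t * outer p ^+ 2 - L1 t * outer p + L2 t =
  kappa * outer p * (p^* * t ^+ 2 - 2 * t + p).
Proof.
rewrite /unimod => h; apply/eqP; rewrite -subr_eq0; apply/eqP.
have -> : 0 = (mu * t ^+ 2 - nu) * (1 - outer p * (outer p)^*) by rewrite h subrr mulr0.
rewrite /L0 /L1 /L2 /kappa /outer !rmorphD !rmorphM /= !conjCK; ring.
Qed.

(** By [chord_form] both ends of the chord are roots; they are distinct, so Vieta expresses [L1 t]
    and [L2 t] through [L0 t]. *)
Lemma chord_factor t p q y : unimod (outer p) -> unimod (outer q) ->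
  tangent_at t p -> tangent_at t q -> p != q ->
  L0 t * y ^+ 2 - L1 t * y + L2 t = L0 t * (y - outer p) * (y - outer q).
Proof.
move=> up uq tp tq pq.
have zero r : tangent_at t r -> r^* * t ^+ 2 - 2 * t + r = 0.
  by move=> <-; ring.
have := chord_form t up; rewrite zero // mulr0 => ep.
have := chord_form t uq; rewrite zero // mulr0 => eq.
have zw : outer p - outer q != 0.
  by rewrite subr_eq0; apply: contra pq => /eqP/outer_inj ->.
have b : L1 t = L0 t * (outer p + outer q).
  apply: (mulIf zw); apply/eqP; rewrite -subr_eq0; apply/eqP.
  have -> : 0 = (L0 t * outer q ^+ 2 - L1 t * outer q + L2 t) -
    (L0 t * outer p ^+ 2 - L1 t * outer p + L2 t) by rewrite ep eq subrr.
  ring.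
have c : L2 t = L0 t * outer p * outer q.
  apply/eqP; rewrite -subr_eq0; apply/eqP; rewrite -[RHS]ep b; ring.
by rewrite b c; ring.
Qed.

(** The two tangency equations are linear in [q] and its conjugate; they make [q] the pole $2 t_1
    t_2/(t_1+t_2)$ of the chord from [t1] to [t2]. *)
Lemma vertex_sides t1 t2 q : unimod t1 -> unimod t2 -> t1 != t2 ->
  tangent_at t1 q -> tangent_at t2 q ->
  [/\ t2 + t1 != 0, q^* * (t2 + t1) = 2 & q = q^* * t1 * t2].
Proof.
rewrite /tangent_at => u1 u2 t12 e1 e2.
have d0 : t2 - t1 != 0 by rewrite subr_eq0 eq_sym.
have es : q^* * (t2 + t1) = 2.
  apply: (mulIf d0); apply/eqP; rewrite -subr_eq0; apply/eqP.
  have -> : q^* * (t2 + t1) * (t2 - t1) - 2 * (t2 - t1) =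
    (q + q^* * t2 ^+ 2 - 2 * t2) - (q + q^* * t1 ^+ 2 - 2 * t1) by ring.
  by rewrite e1 e2 !subrr.
split=> //.
  by apply/eqP => s0; move: es; rewrite s0 mulr0 => /esym/eqP; rewrite pnatr_eq0.
apply/eqP; rewrite -subr_eq0; apply/eqP.
have -> : q - q^* * t1 * t2 = (q + q^* * t1 ^+ 2) - t1 * (q^* * (t2 + t1)) by ring.
by rewrite e1 es; ring.
Qed.

(** The quadratic of the chord is evaluated at a third point in two ways: factored through the ends
    of the chord, and through the two tangents from that point. *)
Lemma chord_vertex t p p' t1 t2 q : unimod (outer p) -> unimod (outer p') ->
  tangent_at t p -> tangent_at t p' -> p != p' ->
  unimod (outer q) -> unimod t1 -> unimod t2 -> t1 != t2 ->
  tangent_at t1 q -> tangent_at t2 q ->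
  L0 t * (outer q - outer p) * (outer q - outer p') * (t2 + t1) =
  2 * kappa * outer q * (t - t1) * (t - t2).
Proof.
move=> up up' tp tp' pp' uq u1 u2 t12 e1 e2.
rewrite -chord_factor // chord_form //.
have [_ es ep] := vertex_sides u1 u2 t12 e1 e2.
rewrite {3}ep; rewrite -es; ring.
Qed.

(** [kappa] is a linear combination of [L0 t] and its conjugate. *)
Lemma L0_neq0 t : unimod t -> L0 t != 0.
Proof.
move=> ut; apply: contra kappa_neq0 => /eqP e.
have e' : (L0 t)^* = 0 by rewrite e rmorph0.
move: e e'; rewrite /L0 !rmorphB !rmorphM /= !conjCK (unimod_conj ut).
have t0 := unimod_neq0 ut.
move=> e e'; apply/eqP; rewrite /kappa.
have -> : mu * mu^* - nu * nu^* =
  mu * (mu^* - nu^* * (t * t)) + nu^* * t * t * (mu - nu * (t^-1 * t^-1)) by field.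
by rewrite e e' !mulr0 addr0.
Qed.


(* [t i] and [t i.+1] are the tangency points of the two sides through the
   vertex [x i]. *)
Record polygon (n : nat) (x t : nat -> C) : Prop := Polygon {
  polygon_size : (0 < n)%N;
  polygon_xper : forall i, x (i + n)%N = x i;
  polygon_tper : forall i, t (i + n)%N = t i;
  polygon_unit : forall i, unimod (t i);
  polygon_in : forall i, tangent_at (t i) (x i);
  polygon_out : forall i, tangent_at (t i.+1) (x i);
  polygon_turn : forall i, t i != t i.+1;
  polygon_on : forall i, unimod (outer (x i));
  polygon_step : forall i, x i != x i.+1 }.

(* ['i] times the signed length of the tangents from [x i] to the unit circle. *)
Definition half (t : nat -> C) i := (t i.+1 - t i) / (t i.+1 + t i).

(* All tangent lengths have the same sign (see [half_sign]), so these ratios are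
   positive reals. *)
Definition weight (t : nat -> C) i := half t i / half t 0.

(** * Tangent lengths and the function $v$ of one polygon *)

Section OnePolygon.
Variables (n : nat) (x t : nat -> C).
Hypothesis P : polygon n x t.

Lemma polygon_sum_neq0 i : t i.+1 + t i != 0.
Proof.
by have [] := vertex_sides (polygon_unit P i) (polygon_unit P i.+1)
  (polygon_turn P i) (polygon_in P i) (polygon_out P i).
Qed.

Lemma vertex_neq0 i : (x i)^* != 0.
Proof.
have [_ e _] := vertex_sides (polygon_unit P i) (polygon_unit P i.+1)
  (polygon_turn P i) (polygon_in P i) (polygon_out P i).
by apply/eqP => x0; move: e; rewrite x0 mul0r => /esym/eqP; rewrite pnatr_eq0.
Qed.

Lemma vertexE_in i : x i = t i * (1 + half t i).
Proof.
have [s0 es ep] := vertex_sides (polygon_unit P i) (polygon_unit P i.+1)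
  (polygon_turn P i) (polygon_in P i) (polygon_out P i).
apply: (mulIf s0); rewrite ep /half.
have -> : (x i)^* * t i * t i.+1 * (t i.+1 + t i) =
   ((x i)^* * (t i.+1 + t i)) * t i * t i.+1 by ring.
by rewrite es; field.
Qed.

Lemma vertexE_out i : x i = t i.+1 * (1 - half t i).
Proof. by rewrite vertexE_in /half; have s0 := polygon_sum_neq0 i; field. Qed.

Lemma half_conj i : (half t i)^* = - half t i.
Proof.
rewrite /half rmorphM fmorphV rmorphB rmorphD /=.
rewrite !(unimod_conj (polygon_unit P _)).
have a0 := unimod_neq0 (polygon_unit P i).
have b0 := unimod_neq0 (polygon_unit P i.+1).
have s0 := polygon_sum_neq0 i.
have s1 : t i + t i.+1 != 0 by rewrite addrC.
by field; rewrite ?a0 ?b0 ?s0 ?s1.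
Qed.

Lemma half_neq0 i : half t i != 0.
Proof.
rewrite mulf_neq0 ?invr_eq0 ?polygon_sum_neq0 //.
by rewrite subr_eq0 eq_sym (polygon_turn P).
Qed.

Lemma half_sqr_lt0 i : half t i ^+ 2 < 0.
Proof.
have := mul_conjC_gt0 (half t i); rewrite half_neq0 half_conj mulrN oppr_gt0.
by rewrite expr2.
Qed.

(** The tangent at [u] is parametrised by [u * (1 - s)] with [s] imaginary; the equation says that
    the point lies on the outer ellipse. *)
Lemma tangent_circle u s : unimod u -> s^* = - s -> unimod (outer (u * (1 - s))) ->
  let c := outer u in let d := mu * u - nu * u^* in
  d * d^* * s ^+ 2 - (c * d^* - d * c^*) * s + (1 - c * c^*) = 0.
Proof.
move=> uu es h c d; rewrite /unimod in h.
have e : outer (u * (1 - s)) = c - s * d.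
  by rewrite /c /d /outer !rmorphM /= rmorphB /= rmorph1 es; ring.
have e' : (outer (u * (1 - s)))^* = c^* + s * d^*.
  by rewrite e rmorphB rmorphM /= es; ring.
move: h; rewrite e' e => h.
have -> : d * d^* * s ^+ 2 - (c * d^* - d * c^*) * s + (1 - c * c^*) =
  1 - (c - s * d) * (c^* + s * d^*) by ring.
by rewrite h subrr.
Qed.

(* The tangency point [t i.+1] is inside the outer circle, so it separates
   [x i] from [x i.+1]. *)
Lemma half_sign i : half t i * half t i.+1 < 0.
Proof.
set u := t i.+1; set s := half t i; set s' := half t i.+1.
have uu : unimod u by apply: (polygon_unit P).
have e1 := tangent_circle uu (half_conj i).
rewrite -/u -vertexE_out in e1; have {}e1 := e1 (polygon_on P i).
have es' : (- s')^* = - (- s') by rewrite rmorphN /= half_conj.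
have e2 := tangent_circle uu es'; rewrite opprK -vertexE_in in e2.
have {}e2 := e2 (polygon_on P i.+1); move: e1 e2 => /=.
set c := outer u; set d := mu * u - _; rewrite -/s => e1 e2.
have c1 : 0 < 1 - c * c^* by rewrite subr_gt0 nested.
have ss : s + s' != 0.
  apply: contra (polygon_step P i) => /eqP e.
  rewrite vertexE_out vertexE_in -/s -/s'.
  by rewrite (_ : s' = - s) // -[LHS](addKr s) e addr0.
(* Both [s] and [- s'] are roots of one quadratic. Subtraction gives their sum; [ep] then gives
   their product, positive by nesting. *)
have es : c * d^* - d * c^* = d * d^* * (s - s').
  apply: (mulIf ss); apply/eqP; rewrite -subr_eq0; apply/eqP.
  have -> : 0 = (d * d^* * (- s') ^+ 2 - (c * d^* - d * c^*) * (- s') + (1 - c * c^*))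
    - (d * d^* * s ^+ 2 - (c * d^* - d * c^*) * s + (1 - c * c^*)) by rewrite e1 e2 subrr.
  by ring.
have ep : d * d^* * - (s * s') = 1 - c * c^*.
  apply/eqP; rewrite -subr_eq0; apply/eqP.
  by rewrite -[RHS]oppr0 -[in RHS]e1 es; ring.
have dge := mul_conjC_ge0 d.
have d0 : 0 < d * d^*.
  rewrite lt_def dge andbT; apply/eqP => d0; move: c1.
  by rewrite -ep d0 mul0r ltxx.
by rewrite -oppr_gt0 -(pmulr_rgt0 _ d0) ep.
Qed.

(** The ratio of consecutive weights is [half t i * half t i.+1] over [half t i ^+ 2], a quotient of
    two negative numbers. *)
Lemma weight_gt0 i : 0 < weight t i.
Proof.
elim: i => [|i IH]; first by rewrite /weight divff ?half_neq0.
have h0 := half_neq0 i; have h00 := half_neq0 0.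
have -> : weight t i.+1 =
    weight t i * ((half t i * half t i.+1) / half t i ^+ 2).
  by rewrite /weight; field; rewrite h0 h00.
by rewrite mulr_gt0 // ltr_ndivlMr ?half_sqr_lt0 // mul0r half_sign.
Qed.

Lemma weight_conj i : (weight t i)^* = weight t i.
Proof. by apply: conj_Creal; apply: gtr0_real; apply: weight_gt0. Qed.

Lemma side_points i y : tangent_at (t i.+1) y -> unimod (outer y) ->
  y = x i \/ y = x i.+1.
Proof.
move=> ty uy.
have := chord_factor (outer y) (polygon_on P i) (polygon_on P i.+1)
  (polygon_out P i) (polygon_in P i.+1) (polygon_step P i).
rewrite chord_form // (_ : _ - _ + _ = 0); last by rewrite -ty; ring.
rewrite mulr0 => /esym/eqP; rewrite !mulf_eq0 (negPf (L0_neq0 (polygon_unit P _))) /=.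
by rewrite !subr_eq0 => /orP[] /eqP/outer_inj ->; [left | right].
Qed.

(** Tangency at [u] is a quadratic equation in [u] with nonzero leading coefficient [(x i)^*] and
    roots [t i], [t i.+1]. *)
Lemma vertex_tangents i u : tangent_at u (x i) -> u = t i \/ u = t i.+1.
Proof.
move=> tu; have [s0 es ep] := vertex_sides (polygon_unit P i) (polygon_unit P i.+1)
  (polygon_turn P i) (polygon_in P i) (polygon_out P i).
have : (x i)^* * ((u - t i) * (u - t i.+1)) == 0.
  have -> : (x i)^* * ((u - t i) * (u - t i.+1)) =
    (x i)^* * u ^+ 2 - ((x i)^* * (t i.+1 + t i)) * u + (x i)^* * t i * t i.+1 by ring.
  by rewrite -ep es -tu; apply/eqP; ring.
rewrite mulf_eq0 (negPf (vertex_neq0 i)) /= mulf_eq0 !subr_eq0.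
by case/orP => /eqP ->; [left | right].
Qed.

(** The function $v_Q$, with tangent lengths normalised as in [weight]. *)
Definition pole y := \sum_(i < n) weight t i * outer (x i) / (outer (x i) - y).

(* By [chord_vertex], the [i]-th term of the difference of the two sides is a
   constant times [1 / (u - t i.+1) - 1 / (u - t i)]: the sum telescopes. *)
Lemma pole_chord u p p' : unimod u ->
  unimod (outer p) -> unimod (outer p') ->
  tangent_at u p -> tangent_at u p' -> p != p' ->
  (forall i, x i != p) -> (forall i, x i != p') ->
  pole (outer p) = pole (outer p').
Proof.
move=> uu up up' tp tp' pp' xp xp'.
have zp i : outer (x i) - outer p != 0.
  by rewrite subr_eq0; apply: contra (xp i) => /eqP/outer_inj ->.
have zp' i : outer (x i) - outer p' != 0.
  by rewrite subr_eq0; apply: contra (xp' i) => /eqP/outer_inj ->.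
have key i := chord_vertex up up' tp tp' pp' (polygon_on P i) (polygon_unit P i)
  (polygon_unit P i.+1) (polygon_turn P i) (polygon_in P i) (polygon_out P i).
have l0 := L0_neq0 uu.
(* If [u] were a tangency point of the polygon, the right side of [key] would vanish, but no factor
   on the left does. *)
have ut i : u - t i != 0.
  apply/eqP => e; move: (key i); rewrite e mulr0 mul0r => /eqP.
  by rewrite !mulf_eq0 (negPf l0) (negPf (zp i)) (negPf (zp' i))
    (negPf (polygon_sum_neq0 i)).
have h0 := half_neq0 0.
have k0 : kappa != 0 by [].
have n2 : 2 != 0 :> C by rewrite pnatr_eq0.
pose K := (outer p - outer p') * L0 u / (2 * kappa * half t 0).
suff term i : weight t i * outer (x i) / (outer (x i) - outer p) -
    weight t i * outer (x i) / (outer (x i) - outer p') =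
    K / (u - t i.+1) - K / (u - t i).
  apply/eqP; rewrite -subr_eq0 /pole -sumrB.
  rewrite (eq_bigr (fun i : 'I_n => K / (u - t i.+1) - K / (u - t i)));
    last by move=> i _; rewrite term.
  rewrite -(big_mkord predT (fun i => K / (u - t i.+1) - K / (u - t i))).
  rewrite telescope_sumr //.
  by rewrite -[X in t X]add0n (polygon_tper P) // subrr.
have a := zp i; have a' := zp' i; have s0 := polygon_sum_neq0 i.
have b := ut i; have b' := ut i.+1.
transitivity (weight t i * outer (x i) * (outer p - outer p') /
   ((outer (x i) - outer p) * (outer (x i) - outer p'))).
  by field; rewrite a a'.
transitivity (K * (t i.+1 - t i) / ((u - t i) * (u - t i.+1))); last first.
  by field; rewrite b b'.
apply/eqP; rewrite eqr_div ?mulf_neq0 //; apply/eqP.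
rewrite /K /weight {1}/half.
transitivity ((outer p - outer p') * (t i.+1 - t i) /
  ((t i.+1 + t i) * (2 * kappa * half t 0)) *
  (2 * kappa * outer (x i) * (u - t i) * (u - t i.+1))).
  by field; rewrite s0 h0 k0.
by rewrite -key; field; rewrite s0 h0 k0.
Qed.

Definition total := \sum_(i < n) weight t i.
Definition moment := \sum_(i < n) weight t i * outer (x i).
Definition bary := moment / total.

Lemma total_gt0 : 0 < total.
Proof.
rewrite /total; have := polygon_size P; case: n => // m _.
rewrite big_ord_recl ltr_wpDr ?weight_gt0 // sumr_ge0 // => i _.
exact/ltW/weight_gt0.
Qed.

Lemma total_conj : total^* = total.
Proof. by apply: conj_Creal; apply/gtr0_real/total_gt0. Qed.

(** Poisson kernel identity: $2\,\mathrm{Re}\,\frac{a}{a-y} = 1 + \frac{1-|y|^2}{|a-y|^2}$ for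
    unimodular $a$. *)
Lemma pole_conj y : (forall i, y != outer (x i)) ->
  pole y + (pole y)^* = total +
    (1 - y * y^*) * \sum_(i < n) weight t i / `|outer (x i) - y| ^+ 2.
Proof.
move=> yx; rewrite /pole /total rmorph_sum mulr_sumr -!big_split /=.
apply: eq_bigr => i _.
have d0 : outer (x i) - y != 0 by rewrite subr_eq0 eq_sym.
have d1 : (outer (x i))^* - y^* != 0 by rewrite -rmorphB conjC_eq0.
have := polygon_on P i; rewrite /unimod => u.
have := weight_conj i; move: (weight t i) => w wc.
rewrite !rmorphM fmorphV /= wc normCK rmorphB /=.
set a := outer (x i) in u d0 d1 *.
transitivity (w * (a * (a^* - y^*) + a^* * (a - y)) / ((a - y) * (a^* - y^*))).
  by field; rewrite d0 d1.
have -> : a * (a^* - y^*) + a^* * (a - y) = (a - y) * (a^* - y^*) + (1 - y * y^*).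
  apply/eqP; rewrite -subr_eq0; apply/eqP.
  transitivity (a * a^* - 1); last by rewrite u subrr.
  by ring.
by field; rewrite d0 d1.
Qed.

End OnePolygon.

(** * Pairs of disjoint polygons *)

Definition disjoint (x y : nat -> C) := forall i j, x i != y j.

Lemma disjointC x y : disjoint x y -> disjoint y x.
Proof. by move=> d i j; rewrite eq_sym. Qed.

(** If [y j.+1] is a vertex of the first polygon, the side leading to it is one of the two sides
    there, so [y j] is already a vertex of the first polygon. *)
Lemma disjoint_from_start n x t m y u : polygon n x t -> polygon m y u ->
  (forall i, x i != y 0) -> disjoint x y.
Proof.
move=> P Q h0 i j; elim: j i => // j IH i; apply/eqP => e.
have tu : tangent_at (u j.+1) (x i) by rewrite e; apply: (polygon_in Q).
have to := polygon_out Q j; have on := polygon_on Q j.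
case: (vertex_tangents P tu) => eu; rewrite eu in to.
  (* The index is moved up by a period so that the preceding vertex exists even for [i = 0]. *)
  have en : (i + n = (i + n).-1.+1)%N.
    by rewrite prednK // addn_gt0 (polygon_size P) orbT.
  rewrite -(polygon_tper P) en in to.
  by case: (side_points P to on) => /eqP; rewrite eq_sym (negPf (IH _)).
by case: (side_points P to on) => /eqP; rewrite eq_sym (negPf (IH _)).
Qed.

Lemma pole_const n x t m y u : polygon n x t -> polygon m y u ->
  disjoint x y -> forall j, pole n x t (outer (y j)) = pole n x t (outer (y 0)).
Proof.
move=> P Q d; elim=> // j <-; apply/esym.
apply: (pole_chord P (polygon_unit Q j.+1)) => //.
- exact: (polygon_on Q).
- exact: (polygon_on Q).
- exact: (polygon_out Q).
- exact: (polygon_in Q).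
- exact: (polygon_step Q).
Qed.

(* Summing [weight u j * pole (y j)] and [weight u j * y j * pole (y j)] over
   the second polygon and exchanging the sums relates the two polygons. *)
Lemma bary_rotation n x t m y u : polygon n x t -> polygon m y u ->
  disjoint x y ->
  let c := pole n x t (outer (y 0)) in
  [/\ c != 0, c + c^* = total n t & bary m y u = - (c^* / c) * bary n x t].
Proof.
move=> P Q d c.
have dz i j : outer (x i) != outer (y j).
  by apply: contra (d i j) => /eqP/(outer_inj) ->.
have W0 := total_gt0 P; have W0' := total_gt0 Q.
have cW : c + c^* = total n t.
  rewrite pole_conj //; last by move=> i; rewrite eq_sym.
  by rewrite (polygon_on Q) subrr mul0r addr0.
have c0 : c != 0.
  by apply/eqP => c0; move: W0; rewrite -cW c0 rmorph0 addr0 ltxx.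
set c' := pole m y u (outer (x 0)).
have pc j : pole n x t (outer (y j)) = c by apply: (pole_const P Q).
have pc' i : pole m y u (outer (x i)) = c' by apply: (pole_const Q P (disjointC d)).
clearbody c c'.
have dd i j : outer (x i) - outer (y j) != 0 by rewrite subr_eq0.
have dd' i j : outer (y j) - outer (x i) != 0 by rewrite subr_eq0 eq_sym.
(* For each pair of vertices, $\frac{a}{a-b} + \frac{b}{b-a} = 1$. *)
have e1 : c * total m u + c' * total n t = total n t * total m u.
  rewrite /total mulr_suml mulr_sumr mulr_sumr.
  rewrite (eq_bigr (fun j : 'I_m => \sum_(i < n)
     weight u j * (weight t i * outer (x i) / (outer (x i) - outer (y j))))); last first.
    by move=> j _; rewrite -mulr_sumr -/(pole n x t (outer (y j))) pc mulrC.
  rewrite exchange_big -big_split; apply: eq_bigr => i _ /=.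
  rewrite -(pc' i) /pole mulr_suml mulr_sumr -big_split; apply: eq_bigr => j _ /=.
  by field; rewrite dd dd'.
(* Here $\frac{ab}{a-b}$ changes sign when the two vertices are exchanged. *)
have e2 : c * moment m y u = - (c' * moment n x t).
  rewrite /moment !mulr_sumr -sumrN.
  rewrite (eq_bigr (fun j : 'I_m => \sum_(i < n) weight u j * outer (y j) *
     (weight t i * outer (x i) / (outer (x i) - outer (y j))))); last first.
    by move=> j _; rewrite -mulr_sumr -/(pole n x t (outer (y j))) pc mulrC.
  rewrite exchange_big; apply: eq_bigr => i _ /=.
  rewrite -(pc' i) /pole mulr_suml -sumrN; apply: eq_bigr => j _ /=.
  by field; rewrite dd dd'.
split=> //; rewrite /bary.
have w0 : total n t != 0 by rewrite gt_eqF.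
have w0' : total m u != 0 by rewrite gt_eqF.
have e3 : c' * total n t = total m u * c^*.
  by rewrite -[LHS](addKr (c * total m u)) e1 -cW; ring.
apply/eqP; rewrite -subr_eq0; apply/eqP.
transitivity ((c * moment m y u * total n t + total m u * c^* * moment n x t) /
  (c * total m u * total n t)).
  by field; rewrite c0 w0 w0'.
by rewrite e2 -e3 (_ : _ + _ = 0) ?mul0r //; ring.
Qed.

Lemma norm_bary_disjoint n x t m y u : polygon n x t -> polygon m y u ->
  disjoint x y -> `|bary m y u| = `|bary n x t|.
Proof.
move=> P Q d; have [c0 _ ->] := bary_rotation P Q d.
by rewrite normrM normrN normrM normfV norm_conjC divff ?mul1r // normr_eq0.
Qed.

(** A closed polygon may run several times round a shorter one; excluding this makes its vertices
    distinct roots. *)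
Definition simple (n : nat) (x : nat -> C) :=
  forall i j, (i < n)%N -> (j < n)%N -> x i = x j -> i = j.

Lemma simple_outer_uniq m y u : polygon m y u -> simple m y ->
  uniq [seq outer (y i) | i <- iota 0 m].
Proof.
move=> Q sy; rewrite map_inj_in_uniq ?iota_uniq // => i j.
by rewrite !mem_iota /= !add0n => im jm /outer_inj; apply: sy.
Qed.

Definition residue n (x t : nat -> C) (i : 'I_n) := weight t i * outer (x i).

Definition pencil n (x t : nat -> C) c :=
  level_poly (fun i : 'I_n => outer (x i)) (@residue n x t) c.

Lemma root_pencil n x t c y : polygon n x t -> (forall i, y != outer (x i)) ->
  root (pencil n x t c) y = (pole n x t y == c).
Proof.
move=> P yx; rewrite rootE /pencil horner_level_poly //.
have -> : \sum_(i < n) residue x t i / (y - outer (x i)) = - pole n x t y.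
  rewrite /pole -sumrN; apply: eq_bigr => i _.
  have d : y - outer (x i) != 0 by rewrite subr_eq0.
  have d' : outer (x i) - y != 0 by rewrite subr_eq0 eq_sym.
  by rewrite /residue; field; rewrite d d'.
rewrite mulf_eq0 subr_eq0 [c == _]eq_sym orb_idl //.
rewrite prodf_seq_eq0 => /hasP[i _ /=].
by rewrite subr_eq0 (negPf (yx i)).
Qed.

(** The [m] distinct vertices are roots of a nonzero polynomial of degree [n]. *)
Lemma simple_size_le n x t m y u : polygon n x t -> polygon m y u ->
  disjoint x y -> simple m y -> (m <= n)%N.
Proof.
move=> P Q d sy; have [c0 _ _] := bary_rotation P Q d.
set c := pole n x t _ in c0.
have szW := size_level_poly (fun i : 'I_n => outer (x i)) (@residue n x t) (polygon_size P) c0.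
have W0 : pencil n x t c != 0 by rewrite -size_poly_gt0 szW.
have := max_poly_roots W0 _ (simple_outer_uniq Q sy).
rewrite szW size_map size_iota ltnS; apply; apply/allP => z /mapP[j _ ->].
rewrite root_pencil // ?(pole_const P Q) // => i.
by apply: contra (d i j) => /eqP/outer_inj ->.
Qed.

Lemma simple_vertex_sum n x t m y u : polygon n x t -> polygon m y u ->
  disjoint x y -> simple n x -> simple m y ->
  m = n /\ \sum_(j < m) outer (y j) - bary m y u =
           \sum_(i < n) outer (x i) - bary n x t.
Proof.
move=> P Q d sx sy.
have mn : m = n.
  apply/eqP; rewrite eqn_leq (simple_size_le P Q) //.
  by rewrite (simple_size_le Q P) //; apply: disjointC.
split=> //; have [c0 cW ->] := bary_rotation P Q d.
set c := pole n x t _ in c0 cW *.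
have n0 := polygon_size P.
have szW := size_level_poly (fun i : 'I_n => outer (x i)) (@residue n x t) n0 c0.
have lcW := lead_coef_level_poly (fun i : 'I_n => outer (x i)) (@residue n x t) n0 c0.
have subW := level_poly_subleading (fun i : 'I_n => outer (x i)) (@residue n x t) c n0.
set rs := [seq outer (y i) | i <- iota 0 m].
have szrs : size rs = n by rewrite size_map size_iota.
(* The [n] distinct vertices of the second polygon exhaust the roots of this polynomial of degree
   [n]. *)
have eW : pencil n x t c = c *: \prod_(z <- rs) ('X - z%:P).
  rewrite -[in RHS]lcW; apply: all_roots_prod_XsubC; rewrite ?szW ?szrs //.
    apply/allP => z /mapP[j _ ->].
    rewrite root_pencil // ?(pole_const P Q) // => i.
    by apply: contra (d i j) => /eqP/outer_inj ->.
  by rewrite uniq_rootsE; apply: (simple_outer_uniq Q).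
have := coefPn_prod_XsubC (ps := rs); rewrite szrs -lt0n => /(_ n0) co.
have : (pencil n x t c)`_n.-1 = - c * \sum_(z <- rs) z.
  by rewrite eW coefZ co mulrN mulNr.
rewrite subW -/(moment n x t) => e.
have er : \sum_(j < m) outer (y j) = \sum_(z <- rs) z.
  by rewrite big_map -(big_mkord predT (fun j => outer (y j))) /index_iota subn0.
have W0 : total n t != 0 by rewrite gt_eqF // (total_gt0 P).
rewrite er; apply: (mulfI c0).
have -> : c * (\sum_(z <- rs) z - - (c^* / c) * bary n x t) =
  - (- c * \sum_(z <- rs) z) + c^* * bary n x t by field.
have -> : c^* = total n t - c by rewrite -cW; ring.
by rewrite -e /bary; field.
Qed.

(* Off the unit circle, [pole z + (pole z)^*] differs from [total], so every
   root of the pencil polynomial for this [c] is unimodular. *)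
Lemma bary_onto n x t w : polygon n x t -> simple n x -> unimod w -> w != 1 ->
  exists z, [/\ unimod z, forall i, z != outer (x i) &
    exists2 c, pole n x t z = c & - (c^* / c) = w].
Proof.
(* The value of [c] is forced by [c + c^* = total n t] and [c^* = - w * c]. *)
move=> P sx uw w1; set c := total n t / (1 - w).
have W0 := total_gt0 P; have W1 : total n t != 0 by rewrite gt_eqF.
have v0 : 1 - w != 0 by rewrite subr_eq0 eq_sym.
have c0 : c != 0 by rewrite mulf_neq0 ?invr_eq0.
have w0 := unimod_neq0 uw.
have v1 : 1 - w^-1 != 0 by rewrite subr_eq0 eq_sym invr_eq1.
have v2 : w - 1 != 0 by rewrite subr_eq0.
have cc : c^* = - w * c.
  rewrite /c rmorphM fmorphV rmorphB /= rmorph1 (unimod_conj uw) (total_conj P).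
  by field; rewrite ?v0 ?w0 ?v2.
have n0 := polygon_size P.
have szW := size_level_poly (fun i : 'I_n => outer (x i)) (@residue n x t) n0 c0.
have [|z rz] := closed_rootP (pencil n x t c) _.
  by rewrite szW eqSS -lt0n.
(* The residues are nonzero and the vertices distinct, so no vertex is a root. *)
have zx' (i : 'I_n) : z != outer (x i).
  apply/eqP => e; move: rz; rewrite rootE e horner_level_poly_node.
  have nz : residue x t i != 0.
    apply: mulf_neq0; last exact: (unimod_neq0 (polygon_on P i)).
    by rewrite gt_eqF // (weight_gt0 P).
  rewrite mulf_eq0 (negPf nz) /= prodf_seq_eq0 => /hasP[j _ /andP[ji]].
  rewrite subr_eq0 => /eqP/outer_inj/sx => /(_ (ltn_ord _) (ltn_ord _)) ij.
  by move: ji; rewrite -val_eqE /= ij eqxx.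
have zx i : z != outer (x i).
  rewrite (_ : x i = x (i %% n)%N); first exact: (zx' (Ordinal (ltn_pmod i n0))).
  rewrite {1}(divn_eq i n); elim: (i %/ n)%N => [|k IH]; first by rewrite add0n.
  by rewrite mulSn -addnA addnC (polygon_xper P).
move: rz; rewrite root_pencil // => /eqP pz.
exists z; split=> //; last first.
  by exists c => //; rewrite cc; field.
have := pole_conj P zx; rewrite pz cc.
have -> : c + - w * c = total n t by rewrite /c; field.
rewrite -[LHS]addr0 => /addrI/esym/eqP; rewrite mulf_eq0 => /orP[].
  by rewrite subr_eq0 => /eqP/esym.
suff S0 : 0 < \sum_(i < n) weight t i / `|outer (x i) - z| ^+ 2 by rewrite gt_eqF.
have pos i : 0 < weight t i / `|outer (x i) - z| ^+ 2.
  by rewrite divr_gt0 ?(weight_gt0 P) // exprn_gt0 // normr_gt0 subr_eq0 eq_sym.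
rewrite (bigD1 (Ordinal n0)) //= ltr_wpDr // sumr_ge0 // => i _.
exact/ltW.
Qed.

(** A common vertex has the same two tangents. Exchanging incoming and outgoing would reverse the
    sign of [half], against positivity of the weights. *)
Lemma polygon_next n x t i j : polygon n x t -> x i = x j ->
  t i = t j /\ x i.+1 = x j.+1.
Proof.
move=> P e.
have ti : tangent_at (t j) (x i) by rewrite e; apply: (polygon_in P).
have to : tangent_at (t j.+1) (x i) by rewrite e; apply: (polygon_out P).
have wi := weight_gt0 P i; have wj := weight_gt0 P j.
have [e0 e1] : t j = t i /\ t j.+1 = t i.+1.
  case: (vertex_tangents P ti) => e0; case: (vertex_tangents P to) => e1 //.
  - by move: (polygon_turn P j); rewrite e0 e1 eqxx.
  - move: wj; rewrite /weight /half e0 e1 => wj.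
    suff : 0 < - weight t i by rewrite oppr_gt0 => /(lt_trans wi); rewrite ltxx.
    have s0 := polygon_sum_neq0 P i.
    have s1 : t i + t i.+1 != 0 by rewrite addrC.
    apply: (lt_le_trans wj); rewrite le_eqVlt; apply/orP; left; apply/eqP.
    by rewrite /weight -mulNr; congr (_ / _); rewrite /half; field; rewrite ?s0 ?s1.
  - by move: (polygon_turn P j); rewrite e0 e1 eqxx.
split=> //.
have tj : tangent_at (t i.+1) (x j.+1) by rewrite -e1; apply: (polygon_in P).
case: (side_points P tj (polygon_on P _)) => // ej.
by move: (polygon_step P j); rewrite -e ej eqxx.
Qed.

(** Take the least [m > 0] with [x m = x 0]. Each vertex determines the next by [polygon_next], so
    [m] is a period, it divides [n], and minimality gives simplicity. *)
Lemma polygon_primitive n x t : polygon n x t ->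
  exists m k, [/\ n = (k * m)%N, polygon m x t & simple m x].
Proof.
move=> P.
have ex : exists m, (0 < m)%N && (x m == x 0).
  by exists n; rewrite (polygon_size P) -[n]add0n (polygon_xper P) eqxx.
case: (ex_minnP ex) => m /andP[m0 /eqP xm] mmin.
have next i j k : x i = x j -> x (i + k)%N = x (j + k)%N.
  move=> e; elim: k => [|k IH]; first by rewrite !addn0.
  by rewrite !addnS; have [] := polygon_next P IH.
have xper i : x (i + m)%N = x i by rewrite addnC (next _ _ i xm).
have Q : polygon m x t.
  case: P => n0 px pt pu pi po ptn pon pst; split=> // i.
  by have [] := polygon_next (Polygon n0 px pt pu pi po ptn pon pst) (xper i).
have xmul k i : x (k * m + i)%N = x i.
  by elim: k => [|k IH]; rewrite ?add0n // mulSn -addnA addnC xper.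
exists m, (n %/ m)%N; split=> //.
  rewrite {1}(divn_eq n m); suff -> : (n %% m = 0)%N by rewrite addn0.
  apply/eqP; rewrite -leqn0 leqNgt; apply/negP => r0.
  have : (m <= n %% m)%N.
    apply: mmin; rewrite r0 /= -(xmul (n %/ m)%N) -divn_eq.
    by rewrite -[n]add0n (polygon_xper P).
  by rewrite leqNgt ltn_pmod.
move=> i j; wlog ij : i j / (i < j)%N.
  move=> wl im jm e; case: (ltngtP i j) => // h; first exact: wl.
  by apply/esym/wl.
move=> im jm e.
(* Advancing both vertices by [m - i] steps turns [x i = x j] into a return to [x 0] after only
   [j - i] steps. *)
have := next _ _ (m - i)%N e; rewrite subnKC; last exact: ltnW.
have -> : (j + (m - i) = (j - i) + m)%N.
  by rewrite addnBA ?(ltnW im) // -addnBAC ?(ltnW ij).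
rewrite xm xper => e'.
have : (m <= j - i)%N by apply: mmin; rewrite subn_gt0 ij -e' eqxx.
by move=> /(leq_trans)/(_ (leq_subr _ _)); rewrite leqNgt jm.
Qed.

Lemma sum_periodic (m k : nat) (f : nat -> C) : (forall i, f (i + m)%N = f i) ->
  \sum_(i < k * m) f i = k%:R * \sum_(i < m) f i.
Proof.
move=> fm; elim: k => [|k IH]; first by rewrite big_ord0 mul0r.
rewrite mulSn addnC big_split_ord /= IH -natr1 mulrDl mul1r; congr (_ + _).
apply: eq_bigr => i _; elim: k {IH} => [//|k IH].
by rewrite mulSn -addnA addnC fm.
Qed.

Lemma weight_period n x t i : polygon n x t -> weight t (i + n)%N = weight t i.
Proof.
by move=> P; rewrite /weight /half -addSn !(polygon_tper P).
Qed.

Lemma bary_multiple m k x t : (0 < k)%N -> polygon m x t ->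
  bary (k * m) x t = bary m x t.
Proof.
move=> k0 P; rewrite /bary /moment /total.
rewrite (@sum_periodic m k (weight t)) => [|i]; last by rewrite (weight_period _ P).
rewrite (@sum_periodic m k (fun i => weight t i * outer (x i))) => [|i]; last first.
  by rewrite (weight_period _ P) (polygon_xper P).
by rewrite -mulf_div divff ?mul1r // pnatr_eq0 -lt0n.
Qed.

(** The Cayley transform of the natural numbers gives infinitely many unimodular points. *)
Lemma unimod_avoid (s : seq C) : exists2 z, unimod z & z \notin s.
Proof.
pose f (k : nat) : C := (1 + 'i * k%:R) / (1 - 'i * k%:R).
have nz k : 1 - 'i * k%:R != 0 :> C.
  apply/eqP => e; have : 'Re (1 - 'i * k%:R : C) = 0 by rewrite e raddf0.
  rewrite raddfB /= (Creal_ReP 1 _) ?rpred1 // mulrC.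
  by rewrite ReMl ?realn // Re_i mulr0 subr0 => /eqP; rewrite oner_eq0.
have cf k : (1 - 'i * k%:R)^* = 1 + 'i * k%:R :> C.
  by rewrite rmorphB rmorph1 rmorphM /= conjCi rmorph_nat mulNr opprK.
have uf k : unimod (f k).
  rewrite /unimod /f rmorphM fmorphV /= cf -cf conjCK cf.
  have n1 : 1 + 'i * k%:R != 0 :> C by rewrite -cf conjC_eq0 nz.
  by field; rewrite nz n1.
have finj : injective f.
  move=> k l /eqP; rewrite /f eqr_div ?nz // -subr_eq0.
  have -> : (1 + 'i * k%:R) * (1 - 'i * l%:R) - (1 + 'i * l%:R) * (1 - 'i * k%:R)
     = 2 * 'i * (k%:R - l%:R) :> C by ring.
  rewrite !mulf_eq0 pnatr_eq0 (negPf (neq0Ci C)) /= subr_eq0 eqr_nat.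
  by move/eqP.
case: (boolP (all (mem s) (map f (iota 0 (size s).+1))))
  => [/allP sub | /allPn[z /mapP[k _ ->] h]].
  have := @uniq_leq_size _ (map f (iota 0 (size s).+1)) s.
  rewrite map_inj_uniq // iota_uniq => /(_ isT sub).
  by rewrite size_map size_iota ltnn.
by exists (f k).
Qed.

(** $4i$ times the signed area of the triangle with vertices $0$, $x$, $y$. *)
Definition cross (x y : C) := x^* * y - x * y^*.

(** * Area and lamina centroid in the inner frame *)

Section Lamina.
Variables (n : nat) (x t : nat -> C).
Hypothesis P : polygon n x t.

Let half_period : half t n = half t 0.
Proof. by rewrite /half -[n]add0n -addSn !(polygon_tper P). Qed.

Let x_period : x n = x 0.
Proof. by rewrite -[n]add0n (polygon_xper P). Qed.

(** Seen from the centre of the unit circle, the triangle over a side has height 1 and base the sum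
    of two tangent lengths. *)
Lemma cross_side i : cross (x i) (x i.+1) = 2 * (half t i + half t i.+1).
Proof.
rewrite /cross (vertexE_out P i) (vertexE_in P i.+1).
rewrite !rmorphM /= rmorphB rmorphD /= rmorph1 !(half_conj P).
rewrite (unimod_conj (polygon_unit P _)).
by have t0 := unimod_neq0 (polygon_unit P i.+1); field.
Qed.

Lemma sum_cross : \sum_(i < n) cross (x i) (x i.+1) = 4 * half t 0 * total n t.
Proof.
rewrite (eq_bigr (fun i : 'I_n => 2 * (half t i + half t i.+1)));
  last by move=> i _; rewrite cross_side.
rewrite -mulr_sumr big_split /= (sum_shift half_period).
have h0 := half_neq0 P 0.
rewrite /total /weight -mulr_suml; move: (\sum_(i < n) half t i) => S.
by field.
Qed.

Lemma sum_cross_neq0 : \sum_(i < n) cross (x i) (x i.+1) != 0.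
Proof.
rewrite sum_cross; apply: mulf_neq0; last by rewrite gt_eqF // (total_gt0 P).
by apply: mulf_neq0; [rewrite pnatr_eq0 | apply: half_neq0 P 0].
Qed.

Definition vertex_mean := (\sum_(i < n) weight t i * x i) / total n t.

(* Each side gives [half t i * x i.+1 + half t i.+1 * x i = x i.+1 - x i], so the
   mixed terms cancel around the polygon. *)
Lemma sum_cross_moment :
  \sum_(i < n) cross (x i) (x i.+1) * (x i + x i.+1) =
  (\sum_(i < n) cross (x i) (x i.+1)) * vertex_mean.
Proof.
have W0 : total n t != 0 by rewrite gt_eqF // (total_gt0 P).
have h0 := half_neq0 P 0.
rewrite sum_cross /vertex_mean.
transitivity (4 * \sum_(i < n) half t i * x i); last first.
  have -> : \sum_(i < n) weight t i * x i = (\sum_(i < n) half t i * x i) / half t 0.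
    by rewrite mulr_suml; apply: eq_bigr => i _; rewrite /weight mulrAC.
  by move: (\sum_(i < n) half t i * x i) => S; field; rewrite W0 h0.
pose f i := half t i * x i.
rewrite (eq_bigr (fun i : 'I_n => 2 * (f i + f i.+1 + (x i.+1 - x i)))); last first.
  move=> i _; rewrite cross_side /f.
  by rewrite (vertexE_out P i) (vertexE_in P i.+1); ring.
rewrite -mulr_sumr !big_split /= sumrN (sum_shift x_period) subrr addr0.
rewrite sum_shift; last by rewrite /f half_period x_period.
by rewrite -mulr2n -[X in _ * X]mulr_natl mulrA -natrM.
Qed.

(** The weights are real, so the real-affine map [outer] commutes with weighted means. *)
Lemma outer_vertex_mean : outer vertex_mean = bary n x t.
Proof.
have W0 : total n t != 0 by rewrite gt_eqF // (total_gt0 P).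
apply: (mulIf W0); rewrite /bary /vertex_mean divfK // /outer.
rewrite rmorphM fmorphV rmorph_sum /= (total_conj P).
rewrite !mulrDl -!mulrA mulVf // !mulr1 /moment /total.
rewrite 3!mulr_sumr -!big_split; apply: eq_bigr => i _ /=.
have := weight_conj P i; move: (weight t i) => w wc.
by rewrite rmorphM /= wc /outer; ring.
Qed.

End Lamina.

(** * Families with a polygon through every point *)

Section Family.
Variables (n : nat) (fam : (nat -> C) -> (nat -> C) -> Prop).
Hypothesis fam_polygon : forall x t, fam x t -> polygon n x t.
Hypothesis fam_through : forall z, unimod z ->
  exists x t, fam x t /\ outer (x 0) = z.

Lemma polygon_mod k x t i : polygon k x t -> exists2 j, (j < k)%N & x i = x j.
Proof.
move=> P; exists (i %% k)%N; first by rewrite ltn_pmod // (polygon_size P).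
rewrite {1}(divn_eq i k); elim: (i %/ k)%N => [|l IH]; first by rewrite add0n.
by rewrite mulSn -addnA addnC (polygon_xper P).
Qed.

(** Two polygons that may share vertices are compared through a third one, started away from
    both. *)
Lemma common_disjoint x t y u : fam x t -> fam y u ->
  exists z v, [/\ fam z v, disjoint x z & disjoint y z].
Proof.
move=> /fam_polygon P /fam_polygon Q.
have [w uw wn] := unimod_avoid
  ([seq outer (x i) | i <- iota 0 n] ++ [seq outer (y i) | i <- iota 0 n]).
have [z [v [F e]]] := fam_through uw; have R := fam_polygon F.
move: wn; rewrite mem_cat negb_or => /andP[wx wy].
exists z, v; split=> //.
  apply: (disjoint_from_start P R) => i; apply: contra wx => /eqP ez.
  have [j jn ej] := polygon_mod i P.
  by rewrite -e -ez ej; apply/mapP; exists j; rewrite ?mem_iota.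
apply: (disjoint_from_start Q R) => i; apply: contra wy => /eqP ez.
have [j jn ej] := polygon_mod i Q.
by rewrite -e -ez ej; apply/mapP; exists j; rewrite ?mem_iota.
Qed.

Lemma norm_bary x t y u : fam x t -> fam y u -> `|bary n x t| = `|bary n y u|.
Proof.
move=> F G; have [z [v [H d d']]] := common_disjoint F G.
rewrite -(norm_bary_disjoint (fam_polygon F) (fam_polygon H) d).
by rewrite -(norm_bary_disjoint (fam_polygon G) (fam_polygon H) d').
Qed.

(** Disjoint polygons have primitive polygons of equal length, hence equal multiplicity [k], which
    scales the vertex sum but not the barycentre. *)
Lemma vertex_sum_disjoint x t y u m k m' k' : fam x t -> fam y u ->
  n = (k * m)%N -> polygon m x t -> simple m x ->
  n = (k' * m')%N -> polygon m' y u -> simple m' y -> disjoint x y ->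
  k' = k /\ \sum_(i < n) outer (y i) - k%:R * bary n y u =
            \sum_(i < n) outer (x i) - k%:R * bary n x t.
Proof.
move=> F G nk P sx nk' Q sy d.
have [em es] := simple_vertex_sum P Q d sx sy.
have n0 := polygon_size (fam_polygon F).
have m0 := polygon_size P.
have ek : k' = k.
  by apply/eqP; rewrite -(eqn_pmul2r m0) -nk nk' em.
have k0 : (0 < k)%N by move: n0; rewrite nk muln_gt0 => /andP[].
split=> //; move: Q es; rewrite em => Q es.
rewrite nk !bary_multiple //.
rewrite (@sum_periodic m k (fun i => outer (x i))) => [|i]; last first.
  by rewrite (polygon_xper P).
rewrite (@sum_periodic m k (fun i => outer (y i))) => [|i]; last first.
  by rewrite (polygon_xper Q).
by rewrite -!mulrBr es.
Qed.

Lemma vertex_sum : exists (k : nat) (K : C), (0 < k)%N /\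
  forall x t, fam x t ->
    \sum_(i < n) outer (x i) = k%:R * bary n x t + K.
Proof.
have u1 : unimod 1 by rewrite /unimod rmorph1 mulr1.
have [x [t [F _]]] := fam_through u1.
have [m [k [nk P sx]]] := polygon_primitive (fam_polygon F).
exists k, (\sum_(i < n) outer (x i) - k%:R * bary n x t); split.
  by have := polygon_size (fam_polygon F); rewrite nk muln_gt0 => /andP[].
move=> y u G; have [z [v [H d d']]] := common_disjoint F G.
have [m1 [k1 [nk1 Q sy]]] := polygon_primitive (fam_polygon G).
have [m2 [k2 [nk2 R sz]]] := polygon_primitive (fam_polygon H).
have [e <-] := vertex_sum_disjoint F H nk P sx nk2 R sz d.
have [e' es] := vertex_sum_disjoint G H nk1 Q sy nk2 R sz d'.
by rewrite -e e' es addrC subrK.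
Qed.

Lemma bary_circle : exists b, 
  (forall x t, fam x t -> exists2 w, unimod w & bary n x t = w * b) /\
  (forall w, unimod w -> exists x t, fam x t /\ bary n x t = w * b).
Proof.
have u1 : unimod 1 by rewrite /unimod rmorph1 mulr1.
have [x [t [F _]]] := fam_through u1; have P := fam_polygon F.
exists (bary n x t); split=> [y u G|w uw].
  have e := norm_bary F G.
  case: (eqVneq (bary n x t) 0) => b0.
    exists 1 => //; rewrite b0 mulr0; apply/eqP.
    by rewrite -normr_eq0 -e b0 normr0.
  exists (bary n y u / bary n x t); last by rewrite divfK.
  rewrite /unimod -normCK normrM normfV e divff ?expr1n // normr_eq0.
  by rewrite -normr_eq0 -e normr_eq0.
(* The factor 1 corresponds to no finite level [c]; the reference polygon itself realises it. *)
case: (eqVneq w 1) => [->|w1]; first by exists x, t; rewrite mul1r.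
have [m [k [nk Q sx]]] := polygon_primitive P.
have k0 : (0 < k)%N by have := polygon_size P; rewrite nk muln_gt0 => /andP[].
have [z [uz zx [c pz ec]]] := bary_onto Q sx uw w1.
have [y [u [G ey]]] := fam_through uz; have R := fam_polygon G.
exists y, u; split=> //.
have d : disjoint x y.
  apply: (disjoint_from_start Q R) => i; apply/eqP => e.
  by move: (zx i); rewrite -ey e eqxx.
have [_ _] := bary_rotation Q R d; rewrite ey pz ec => ->.
by rewrite nk bary_multiple.
Qed.

End Family.

End Pencil.

(** * Return to the real plane *)

Local Notation RR := Rdefinitions.R.
Local Notation CC := (RR[i]%C).

Lemma sum_Complex (n : nat) (f g : nat -> RR) :
  \sum_(i < n) Complex (f i) (g i) = Complex (\sum_(i < n) f i) (\sum_(i < n) g i).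
Proof.
elim: n => [|n IH]; first by rewrite !big_ord0.
by rewrite !big_ord_recr /= IH.
Qed.

Lemma sumRE (n : nat) (f : nat -> RR) : sumR n f = \sum_(i < n) f i.
Proof.
rewrite /sumR -(big_mkord predT f) /index_iota subn0.
have -> : List.seq 0 n = iota 0 n by elim: n 0%N => //= n IH m; rewrite IH.
elim: (iota 0 n) => [|k s IH]; first by rewrite big_nil.
by rewrite big_cons /= IH.
Qed.

Definition chart (E : ellipse) (P : point) : CC := Complex (chart1 E P) (chart2 E P).
Definition chart_inv (E : ellipse) (z : CC) : point := unchart E (complex.Re z) (complex.Im z).

Lemma chartK E P : ellipse_wf E -> chart_inv E (chart E P) = P.
Proof. exact: unchart_chart. Qed.

Lemma chart_invK E z : ellipse_wf E -> chart E (chart_inv E z) = z.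
Proof.
by case: z => a b w; rewrite /chart /chart_inv /= chart1_unchart // chart2_unchart.
Qed.

Lemma Complex_conj (a b : RR) : (Complex a b)^* = Complex a (- b) :> CC.
Proof. by []. Qed.

Lemma ComplexM (a b c d : RR) :
  Complex a b * Complex c d = Complex (a * c - b * d) (a * d + b * c) :> CC.
Proof. by []. Qed.

Lemma ComplexD (a b c d : RR) :
  Complex a b + Complex c d = Complex (a + c) (b + d) :> CC.
Proof. by []. Qed.

Lemma ComplexN (a b : RR) : - Complex a b = Complex (- a) (- b) :> CC.
Proof. by []. Qed.

Definition ComplexE := (Complex_conj, ComplexM, ComplexD, ComplexN).

Lemma mul_conj_Complex (a b : RR) :
  Complex a b * (Complex a b)^* = Complex (a * a + b * b) 0 :> CC.
Proof. by rewrite !ComplexE; congr Complex; ring. Qed.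

Lemma unimod_Complex (a b : RR) : a * a + b * b = 1 <-> unimod (Complex a b : CC).
Proof. by rewrite /unimod mul_conj_Complex; split=> [-> //|[]]. Qed.

Lemma unimod_chart E P : ellipse_wf E -> on_ellipse E P <-> unimod (chart E P).
Proof.
move=> w; rewrite -unimod_Complex /on_ellipse -bform_diag.
by rewrite -(chart_bform _ P P w).
Qed.

Lemma tangent_at_Complex (a b c d : RR) : a * a + b * b = 1 ->
  a * c + b * d = 1 -> tangent_at (Complex a b : CC) (Complex c d).
Proof.
move=> u e; rewrite /tangent_at expr2.
have -> : 2 = Complex (1 + 1) (0 + 0) :> CC by [].
rewrite !ComplexE; congr Complex; apply/eqP; rewrite -subr_eq0; apply/eqP.
  transitivity (c * (1 - (a * a + b * b)) + 2 * a * (a * c + b * d - 1)); first by ring.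
  by rewrite u e !subrr !mulr0 addr0.
transitivity (d * (1 - (a * a + b * b)) + 2 * b * (a * c + b * d - 1)); first by ring.
by rewrite u e !subrr !mulr0 addr0.
Qed.

(** In the chart of [G] the set is the circle of radius [lam] times $|b|$ about [K], a point when
    [b = 0]; since the chart sends [G] to the unit circle, this is a homothetic image of [G]. *)
Lemma circle_locus (G : ellipse) (S : point -> Prop) (lam : RR) (b K : CC) :
  ellipse_wf G -> 0 < lam ->
  (forall p, S p -> exists2 w, unimod w & chart G p = (Complex lam 0) * (w * b) + K) ->
  (forall w, unimod w -> exists2 p, S p & chart G p = (Complex lam 0) * (w * b) + K) ->
  homothetic_ellipse G S \/ single_point S.
Proof.
move=> wG lam0 S1 S2.
case: (eqVneq b 0) => b0.
  right; exists (chart_inv G K) => p; split.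
    by case/S1 => w _; rewrite b0 !mulr0 add0r => <-; rewrite chartK.
  move=> ->; have u1 : unimod (1 : CC) by rewrite /unimod rmorph1 mulr1.
  by have [q Sq] := S2 1 u1; rewrite b0 !mulr0 add0r => <-; rewrite chartK.
left; have [r r0 er] : exists2 r : RR, 0 < r & Complex r 0 = `|b| :> CC.
  case eb: `|b| => [r s]; have : 0 < `|b| by rewrite normr_gt0.
  by rewrite eb ltcE /= => /andP[/eqP -> r0]; exists r.
have rc0 : Complex r 0 != 0 :> CC by rewrite er normr_eq0.
(* The translation is chosen so that the centre of [G] goes to the point with chart value [K]. *)
pose c : point := (fst (chart_inv G K) - lam * r * ecx G, snd (chart_inv G K) - lam * r * ecy G).
have ec z : chart G (lam * r * fst z + fst c, lam * r * snd z + snd c) =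
    Complex lam 0 * Complex r 0 * chart G z + K.
  rewrite -[in RHS](chart_invK K wG) /chart !ComplexE /chart1 /chart2 /c /=.
  by rewrite ?RealsE; congr Complex; ring.
have ub : b * b^* = Complex r 0 * Complex r 0 by rewrite -normCK -er expr2.
have cr : (Complex r 0)^* = Complex r 0 :> CC by rewrite Complex_conj oppr0.
have inj p q : chart G p = chart G q -> p = q.
  by move=> e; rewrite -(chartK p wG) e chartK.
exists (lam * r), c; split; first by apply/RltP; rewrite mulr_gt0.
move=> p; split.
  case/S1 => w uw ep; exists (chart_inv G (w * b / Complex r 0)); split.
    apply/(unimod_chart _ wG); rewrite chart_invK // /unimod !rmorphM fmorphV /= cr.
    transitivity (w * w^* * (b * b^*) / (Complex r 0 * Complex r 0)); first by field.
    by rewrite uw ub mul1r divff // mulf_neq0.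
  by apply: inj; rewrite ec chart_invK // ep; field.
case=> z [/(unimod_chart _ wG) uz ->].
have uw : unimod (chart G z * Complex r 0 / b).
  have b1 : b^* != 0 by rewrite conjC_eq0.
  rewrite /unimod !rmorphM fmorphV /= cr.
  transitivity (chart G z * (chart G z)^* * (Complex r 0 * Complex r 0) / (b * b^*)).
    by field; rewrite b0 b1.
  by rewrite uz mul1r ub divff // mulf_neq0.
have [q Sq eq] := S2 _ uw.
suff -> : (lam * r * fst z + fst c, lam * r * snd z + snd c) = q by [].
by apply: inj; rewrite eq ec divfK //; ring.
Qed.

(** Translation equivariance of the lamina formulas: moving the origin to [(a, b)] changes each
    summand by a telescoping difference, and 3 appears because $6A = 3\sum d_i$. *)
Lemma lamina_shift (F : fieldType) (n : nat) (X Y : nat -> F) (a b : F) :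
  X n = X 0%N -> Y n = Y 0%N ->
  let D i := X i * Y i.+1 - X i.+1 * Y i in
  let U i := X i - a in let V i := Y i - b in
  let d i := U i * V i.+1 - U i.+1 * V i in
  [/\ \sum_(i < n) D i = \sum_(i < n) d i,
      \sum_(i < n) D i * (X i + X i.+1) =
        3 * a * \sum_(i < n) d i + \sum_(i < n) d i * (U i + U i.+1) &
      \sum_(i < n) D i * (Y i + Y i.+1) =
        3 * b * \sum_(i < n) d i + \sum_(i < n) d i * (V i + V i.+1)].
Proof.
move=> Xn Yn D U V d.
have tele (f g h : nat -> F) : h n = h 0%N ->
    (forall i, f i = g i + (h i.+1 - h i)) -> \sum_(i < n) f i = \sum_(i < n) g i.
  move=> hn fg; rewrite (eq_bigr (fun i : 'I_n => g i + (h i.+1 - h i))) //.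
  by rewrite big_split /= sumrB sum_shift // subrr addr0.
split.
- apply: (tele _ _ (fun i => a * V i - b * U i)) => [|i].
    by rewrite /U /V Xn Yn.
  by rewrite /D /d /U /V; ring.
- rewrite mulr_sumr -big_split /=.
  apply: (tele (fun i => D i * (X i + X i.+1)) (fun i => 3 * a * d i + d i * (U i + U i.+1))
    (fun i => (a * V i - b * U i) * (U i + 2 * a))) => [|i].
    by rewrite /U /V Xn Yn.
  by rewrite /D /d /U /V; ring.
- rewrite mulr_sumr -big_split /=.
  apply: (tele (fun i => D i * (Y i + Y i.+1)) (fun i => 3 * b * d i + d i * (V i + V i.+1))
    (fun i => (a * V i - b * U i) * (V i + 2 * b))) => [|i].
    by rewrite /U /V Xn Yn.
  by rewrite /D /d /U /V; ring.
Qed.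

(** * Transfer to a nested pair of ellipses *)

Section Nested.
Variables (g G : ellipse).
Hypotheses (wg : ellipse_wf g) (wG : ellipse_wf G) (gG : ellipse_inside g G).

(** [mu] and [nu] are the complex-linear and conjugate-linear parts of the triangular matrix with
    entries [trans11], [trans12], [trans22]; [o] is the centre of [g] in the chart of [G]. *)
Let o : CC := chart G (ecx g, ecy g).
Let mu : CC := Complex ((trans11 g G + trans22 g G) / 2) (- trans12 g G / 2).
Let nu : CC := Complex ((trans11 g G - trans22 g G) / 2) (trans12 g G / 2).

Lemma outer_chart P : outer o mu nu (chart g P) = chart G P.
Proof.
rewrite /outer /o /chart [in RHS](chart1_trans g G) // [chart2 G P](chart2_trans g G) //.
move: (chart1 G _) (chart2 G _) (chart1 g _) (chart2 g _) => o1 o2 p1 p2.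
by rewrite /mu /nu !ComplexE ?RealsE; congr Complex; field.
Qed.

Lemma chart_det_neq0 : mu * mu^* - nu * nu^* != 0.
Proof.
rewrite /mu /nu !mul_conj_Complex !ComplexE.
have t1 : 0 < trans11 g G.
  by apply: divr_gt0; apply/RltP; apply: chol11_gt0.
have t2 : 0 < trans22 g G.
  by apply: divr_gt0; apply/RltP; apply: chol22_gt0.
apply/eqP; case => e _; have : trans11 g G * trans22 g G = 0.
  by rewrite -[RHS]e; field.
by apply/eqP; rewrite gt_eqF // mulr_gt0.
Qed.

Lemma outer_nested t : unimod t -> outer o mu nu t * (outer o mu nu t)^* < 1.
Proof.
move=> ut; rewrite -(chart_invK t wg) outer_chart mul_conj_Complex ltcE /= eqxx /=.
apply/RltP; have := chart_bform G (chart_inv g t) (chart_inv g t) wG.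
rewrite RealsE => ->; rewrite bform_diag; apply: gG.
by apply/(unimod_chart _ wg); rewrite chart_invK.
Qed.

Variable n : nat.
Hypothesis n_gt0 : (0 < n)%N.

Lemma vtx_add P i : vtx n P (i + n)%N = vtx n P i.
Proof.
rewrite /vtx; congr P; have := PeanoNat.Nat.Div0.mod_add i 1 n.
by rewrite PeanoNat.Nat.mul_1_l.
Qed.

Lemma vtx_mod P i k : vtx n P (Nat.modulo i n + k)%N = vtx n P (i + k)%N.
Proof. by rewrite /vtx; congr P; apply: PeanoNat.Nat.Div0.add_mod_idemp_l. Qed.

Lemma poncelet_all P : poncelet_ngon g G n P -> forall i,
  [/\ on_ellipse G (vtx n P i), tangent_line g (vtx n P i) (vtx n P i.+1) &
      ~ on_line (vtx n P i.+1) (vtx n P i.+2) (vtx n P i)].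
Proof.
move=> PP i; have lt : Peano.lt (Nat.modulo i n) n.
  by apply: PeanoNat.Nat.mod_upper_bound => n0; move: n_gt0; rewrite n0.
have := PP _ lt.
rewrite -[Nat.modulo i n]addn0 -!addnS !vtx_mod !addnS addn0.
by case=> [? []].
Qed.

Lemma polygon_of_poncelet P : poncelet_ngon g G n P ->
  exists t, polygon o mu nu n (fun i => chart g (vtx n P i)) t.
Proof.
move=> /poncelet_all PP.
have /choice[sd hsd] : forall AB : point * point, exists q, tangent_line g AB.1 AB.2 ->
    [/\ on_ellipse g q, bform g q AB.1 = 1 & bform g q AB.2 = 1].
  (* [AB.1] is a default value for pairs not spanning a tangent line. *)
  move=> AB; case: (pselect (tangent_line g AB.1 AB.2)) => h; last by exists AB.1.
  by have [q [? [? ?]]] := tangent_polar _ _ _ wg h; exists q.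
pose s i := sd (vtx n P i, vtx n P i.+1).
have hs i : [/\ on_ellipse g (s i), bform g (s i) (vtx n P i) = 1 &
    bform g (s i) (vtx n P i.+1) = 1].
  by apply: (hsd (vtx n P i, vtx n P i.+1)); case: (PP i).
have en i : ((i + n.-1).+1 = i + n)%N by rewrite -addnS prednK.
have tg i A : bform g (s i) A = 1 -> tangent_at (chart g (s i)) (chart g A).
  have [so _ _] := hs i => e; apply: tangent_at_Complex.
    by apply/unimod_Complex; apply/(unimod_chart _ wg).
  by rewrite -[RHS]e -(chart_bform g).
have ss i : s (i + n)%N = s i by rewrite /s -addSn !vtx_add.
(* Shifting by [n.-1] is stepping back by one modulo [n]: [t i] belongs to the side arriving at
   vertex [i]. *)
exists (fun i => chart g (s (i + n.-1)%N)); split=> //.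
- by move=> i; rewrite vtx_add.
- by move=> i; rewrite addnAC ss.
- by move=> i; apply/(unimod_chart _ wg); have [] := hs (i + n.-1)%N.
- by move=> i; apply: tg; have [_ _] := hs (i + n.-1)%N; rewrite en vtx_add.
- by move=> i; apply: tg; rewrite addSn en ss; have [] := hs i.
(* Equal consecutive tangency points would put three successive vertices on one polar line. *)
- move=> i; apply/eqP => e.
  have {e} e : s (i + n.-1)%N = s i.
    by rewrite -(chartK (s i) wg) -(chartK (s _) wg) e addSn en ss.
  have [_ _ nl] := PP (i + n.-1)%N; apply: nl.
  have [_ e1 e2] := hs (i + n.-1)%N; have [_ _ e3] := hs i.
  apply: (polar_collinear g (s (i + n.-1)%N)) => //.
    by have [_ [] ] := PP (i + n.-1).+1.
  by rewrite e en -addSn vtx_add.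
- by move=> i; rewrite outer_chart; apply/(unimod_chart _ wG); case: (PP i).
- move=> i; apply/eqP => e; have [_ [ne _] _] := PP i; apply: ne.
  by rewrite -(chartK (vtx n P i) wg) e chartK.
Qed.

Lemma chart_CM0 P : n%:R * chart G (CM0 n P) = \sum_(i < n) chart G (vtx n P i).
Proof.
have nn : n%:R != 0 :> RR by rewrite pnatr_eq0 -lt0n.
rewrite /chart (sum_Complex n (fun i => chart1 G (vtx n P i)) (fun i => chart2 G (vtx n P i))).
rewrite /CM0 !sumRE /chart1 /chart2 /= !INRE.
have -> : n%:R = Complex n%:R 0 :> CC by rewrite -[LHS](rmorph_nat (real_complex RR) n).
rewrite !ComplexE ?RealsE.
have sub (c : RR) (f : nat -> RR) :
    \sum_(i < n) (f i - c) = \sum_(i < n) f i - n%:R * c.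
  by rewrite sumrB sumr_const card_ord mulr_natl.
pose X i := fst (vtx n P i); pose Y i := snd (vtx n P i).
congr Complex.
  transitivity (chol11 G * \sum_(i < n) (X i - ecx G) + chol12 G * \sum_(i < n) (Y i - ecy G)).
    by rewrite !sub; field.
  by rewrite 2!mulr_sumr -big_split; apply: eq_bigr.
transitivity (chol22 G * \sum_(i < n) (Y i - ecy G)); first by rewrite sub; field.
by rewrite mulr_sumr; apply: eq_bigr.
Qed.

(** The chart of [g] is affine and multiplies areas by [chol11 g * chol22 g], so the lamina formula
    in the plane becomes [sum_cross_moment]. *)
Lemma chart_CM2 P t : polygon o mu nu n (fun i => chart g (vtx n P i)) t ->
  3 * chart g (CM2 n P) = vertex_mean n (fun i => chart g (vtx n P i)) t.
Proof.
move=> Q; have := sum_cross_moment outer_nested Q; have := sum_cross_neq0 outer_nested Q.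
case: (vertex_mean _ _ _) => m1 m2.
pose a i := chart1 g (vtx n P i); pose b i := chart2 g (vtx n P i).
pose X i := fst (vtx n P i); pose Y i := snd (vtx n P i).
pose e i := a i * b i.+1 - a i.+1 * b i.
have ce i : cross (chart g (vtx n P i)) (chart g (vtx n P i.+1)) = Complex 0 (2 * e i).
  by rewrite /cross /chart !ComplexE; congr Complex; rewrite /e /a /b; ring.
have -> : \sum_(i < n) cross (chart g (vtx n P i)) (chart g (vtx n P i.+1)) =
    Complex 0 (2 * \sum_(i < n) e i).
  rewrite (eq_bigr (fun i : 'I_n => Complex 0 (2 * e i))); last by move=> i _; apply: ce.
  by rewrite (sum_Complex n (fun i => 0) (fun i => 2 * e i)) big1 // mulr_sumr.
(* The cross products are purely imaginary, so the second coordinate lands in the real part with a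
   sign. *)
have -> : \sum_(i < n) cross (chart g (vtx n P i)) (chart g (vtx n P i.+1)) *
    (chart g (vtx n P i) + chart g (vtx n P i.+1)) =
    Complex (- 2 * \sum_(i < n) e i * (b i + b i.+1)) (2 * \sum_(i < n) e i * (a i + a i.+1)).
  rewrite !mulr_sumr -(sum_Complex n (fun i => - 2 * (e i * (b i + b i.+1)))
    (fun i => 2 * (e i * (a i + a i.+1)))).
  apply: eq_bigr => i _; rewrite ce /chart !ComplexE -/(a i) -/(b i) -/(a i.+1) -/(b i.+1).
  by congr Complex; ring.
rewrite !ComplexE !mul0r sub0r add0r.
set S := \sum_(i < n) e i => S0 [Eb Ea].
have {}S0 : S != 0 by apply: contra S0 => /eqP ->; rewrite mulr0.
have {}Ea : \sum_(i < n) e i * (a i + a i.+1) = S * m1.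
  by apply: (@mulfI _ 2); rewrite ?pnatr_eq0 // Ea; ring.
have {}Eb : \sum_(i < n) e i * (b i + b i.+1) = S * m2.
  by apply: (@mulfI _ (- 2)); rewrite ?oppr_eq0 ?pnatr_eq0 // Eb; ring.
have c1 : chol11 g != 0 by rewrite gt_eqF //; apply/RltP; apply: chol11_gt0.
have c2 : chol22 g != 0 by rewrite gt_eqF //; apply/RltP; apply: chol22_gt0.
pose U i := X i - ecx g; pose V i := Y i - ecy g.
have aE i : a i = chol11 g * U i + chol12 g * V i by [].
have bE i : b i = chol22 g * V i by [].
have eE i : e i = chol11 g * chol22 g * (U i * V i.+1 - U i.+1 * V i).
  by rewrite /e !aE !bE; ring.
have per : vtx n P n = vtx n P 0 by have := vtx_add P 0.
have [] := @lamina_shift _ n X Y (ecx g) (ecy g).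
- by rewrite /X per.
- by rewrite /Y per.
rewrite -/U -/V; set d := fun i => U i * V i.+1 - U i.+1 * V i => D0 D1 D2.
have Sd : S = chol11 g * chol22 g * \sum_(i < n) d i.
  by rewrite /S mulr_sumr; apply: eq_bigr => i _; rewrite eE.
have d0 : \sum_(i < n) d i != 0.
  by apply: contra S0 => /eqP; rewrite Sd => ->; rewrite mulr0.
have EV : chol22 g * \sum_(i < n) d i * (V i + V i.+1) = (\sum_(i < n) d i) * m2.
  apply: (mulfI (mulf_neq0 c1 c2)); rewrite [RHS]mulrA -Sd -Eb [LHS]mulrA mulr_sumr.
  apply: eq_bigr => i _.
  by rewrite eE !bE /d; ring.
have EU : chol11 g * \sum_(i < n) d i * (U i + U i.+1) +
   chol12 g * \sum_(i < n) d i * (V i + V i.+1) = (\sum_(i < n) d i) * m1.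
  apply: (mulfI (mulf_neq0 c1 c2)); rewrite [RHS]mulrA -Sd -Ea.
  transitivity (chol11 g * chol22 g * chol11 g * \sum_(i < n) d i * (U i + U i.+1) +
    chol11 g * chol22 g * chol12 g * \sum_(i < n) d i * (V i + V i.+1)); first by ring.
  rewrite 2!mulr_sumr -big_split /=.
  by apply: eq_bigr => i _; rewrite eE !aE /d; ring.
have area (c : RR) (F : nat -> RR) (T : RR) :
    \sum_(i < n) F i = 3 * c * \sum_(i < n) d i + T ->
    Rmult (Rinv (Rmult 6 (signed_area n P))) (sumR n F) = c + T / (3 * \sum_(i < n) d i).
  move=> e3; rewrite /signed_area !sumRE e3 -D0 ?RealsE.
  have -> : \sum_(i < n) dcross n P i = \sum_(i < n) (X i * Y i.+1 - X i.+1 * Y i) by [].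
  rewrite D0 /=; field; exact: d0.
have cm1 := area _ (fun i => Rmult (dcross n P i) (Rplus (X i) (X i.+1)))
  (\sum_(i < n) d i * (U i + U i.+1)) D1.
have cm2 := area _ (fun i => Rmult (dcross n P i) (Rplus (Y i) (Y i.+1)))
  (\sum_(i < n) d i * (V i + V i.+1)) D2.
rewrite !addr0 !mul0r subr0 addr0 /chart1 /chart2 /CM2 cm1 cm2 ?RealsE.
congr Complex; rewrite /fst /snd.
  apply: (mulIf d0); rewrite [RHS]mulrC -EU; field; exact: d0.
by apply: (mulIf d0); rewrite [RHS]mulrC -EV; field; exact: d0.
Qed.

Lemma ngon_loci :
  (forall A : point, on_ellipse G A ->
     exists P : nat -> point, poncelet_ngon g G n P /\ P 0%N = A) ->
  (homothetic_ellipse G (locus CM0 g G n) \/ single_point (locus CM0 g G n)) /\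
  (homothetic_ellipse G (locus CM2 g G n) \/ single_point (locus CM2 g G n)).
Proof.
move=> porism.
(* Each member keeps its plane polygon, so that a barycentre can be traced back to a point of the
   locus. *)
pose fam (x t : nat -> CC) := polygon o mu nu n x t /\
  exists2 P, poncelet_ngon g G n P & x = fun i => chart g (vtx n P i).
have famP P : poncelet_ngon g G n P -> exists t, fam (fun i => chart g (vtx n P i)) t.
  by move=> PP; have [t Q] := polygon_of_poncelet PP; exists t; split=> //; exists P.
have fam_polygon x t : fam x t -> polygon o mu nu n x t by case.
have fam_through z : unimod z -> exists x t, fam x t /\ outer o mu nu (x 0%N) = z.
  move=> uz; have [|P [PP P0]] := porism (chart_inv G z).
    by apply/(unimod_chart _ wG); rewrite chart_invK.
  have [t F] := famP P PP; exists (fun i => chart g (vtx n P i)), t; split=> //.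
  by rewrite outer_chart /vtx PeanoNat.Nat.Div0.mod_0_l P0 chart_invK.
have [b [onto into]] := bary_circle chart_det_neq0 outer_nested fam_polygon fam_through.
have [k [K [k0 vs]]] := vertex_sum chart_det_neq0 outer_nested fam_polygon fam_through.
have nc : n%:R != 0 :> CC by rewrite pnatr_eq0 -lt0n.
have e0 P t w : fam (fun i => chart g (vtx n P i)) t -> 
    bary o mu nu n (fun i => chart g (vtx n P i)) t = w * b ->
    chart G (CM0 n P) = Complex (k%:R / n%:R) 0 * (w * b) + K / n%:R.
  move=> F ew; apply: (mulfI nc); rewrite chart_CM0.
  rewrite -(eq_bigr _ (fun i _ => outer_chart (vtx n P (nat_of_ord i)))) (vs _ _ F) ew.
  have -> : Complex (k%:R / n%:R) 0 = k%:R / n%:R :> CC.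
    by rewrite [LHS](fmorph_div (real_complex RR)) !rmorph_nat.
  by field.
(* Since [outer] is affine with [outer 0 = o], three times the centroid in the inner frame gives the
   extra term $2o$. *)
have e2 P t w : fam (fun i => chart g (vtx n P i)) t -> 
    bary o mu nu n (fun i => chart g (vtx n P i)) t = w * b ->
    chart G (CM2 n P) = Complex (3^-1) 0 * (w * b) + 2 / 3 * o.
  move=> [Q _] ew; have n3 : 3 != 0 :> CC by rewrite pnatr_eq0.
  have := outer_vertex_mean outer_nested Q; rewrite -(chart_CM2 Q) ew -outer_chart.
  rewrite /outer rmorphM /= rmorph_nat => <-.
  have -> : Complex 3^-1 0 = 3^-1 :> CC.
    by rewrite [LHS](fmorphV (real_complex RR)) !rmorph_nat.
  by field.
split; [apply: (@circle_locus G _ (k%:R / n%:R) b (K / n%:R)) |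
  apply: (@circle_locus G _ 3^-1 b (2 / 3 * o))] => //.
- by rewrite divr_gt0 // ltr0n.
- move=> p [P [PP ->]]; have [t F] := famP P PP.
  by have [w uw ew] := onto _ _ F; exists w => //; apply: e0 F ew.
- move=> w uw; have [x [t [F ew]]] := into w uw.
  have [_ [P PP ex]] := F; rewrite ex in F ew.
  by exists (CM0 n P); [exists P | apply: e0 F ew].
- by rewrite invr_gt0 ltr0n.
- move=> p [P [PP ->]]; have [t F] := famP P PP.
  by have [w uw ew] := onto _ _ F; exists w => //; apply: e2 F ew.
- move=> w uw; have [x [t [F ew]]] := into w uw.
  have [_ [P PP ex]] := F; rewrite ex in F ew.
  by exists (CM2 n P); [exists P | apply: e2 F ew].
Qed.

End Nested.

End PonceletPencil.

Theorem theorem1 (g G : ellipse) (n : nat) :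
  ellipse_wf g -> ellipse_wf G -> ellipse_inside g G -> (3 <= n)%nat ->
  (forall A : point, on_ellipse G A ->
     exists P : nat -> point, poncelet_ngon g G n P /\ P 0%nat = A) ->
  (homothetic_ellipse G (locus CM0 g G n) \/ single_point (locus CM0 g G n)) /\
  (homothetic_ellipse G (locus CM2 g G n) \/ single_point (locus CM2 g G n)).
Proof.
intros wg wG gG hn; apply PonceletPencil.ngon_loci; auto.
destruct n; [inversion hn | reflexivity].
Qed.
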